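(* Let $R,L,d\in(0,\infty)$ and $\alpha\in(0,1]$. Every sequence $(\Sigma_j)_{j\in\mathbb{N}}\subset\mathscr{C}^{1,\alpha}_{m,n}(R,L,d)$ has a subsequence which converges in $\mathscr{C}^{1,\alpha}_{m,n}$ to some submanifold $\Sigma_0\in\mathscr{C}^{1,\alpha}_{m,n}(R,L,d)$.
   Context: $\mathscr{C}^{1,\alpha}_{m,n}$ is the set of compact $C^{1,\alpha}$ embedded $m$-dimensional submanifolds of $\mathbb{R}^n$. $\mathscr{C}^{1,\alpha}_{m,n}(R,L,d)$ is the set of $\Sigma\in\mathscr{C}^{1,\alpha}_{m,n}$ such that: (i) $\Sigma\subset\overline{B}^n(0,d)$; (ii) for each $x\in\Sigma$ there is $f_x\in C^{1,\alpha}(T_x\Sigma,(T_x\Sigma)^\perp)$ with $\Sigma\cap B(x,R)=(x+\operatorname{graph}f_x)\cap B(x,R)$, $f_x(0)=0$, $Df_x(0)=0$; (iii) $\|Df_x(\xi)-Df_x(\eta)\|\le L|\xi-\eta|^\alpha$ for all $\xi,\eta\in T_x\Sigma$ and $\operatorname{lip}(f_x)\le1$. A sequence $(\Sigma_j)\subset\mathscr{C}^{1,\alpha}_{m,n}$ converges in $\mathscr{C}^{1,\alpha}_{m,n}$ to a set $\Sigma_0\subset\mathbb{R}^n$ if: (a) $d_{\mathcal{H}}(\Sigma_j,\Sigma_0)\to0$; (b) $\Sigma_0$ is a $C^{1,\alpha}$ embedded submanifold; (c) there are $j_0\in\mathbb{N}$ and $\rho>0$ such that for each $x\in\Sigma_0$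 and each $j\ge j_0$ or $j=0$ there is $f_{x,j}\in C^{1,\alpha}(T_x\Sigma_0,(T_x\Sigma_0)^\perp)$ with $\Sigma_j\cap B(x,\rho)=(x+\operatorname{graph}f_{x,j})\cap B(x,\rho)$ and $\|f_{x,j}-f_{x,0}\|_{C^{1,\alpha'}}\to0$ as $j\to\infty$ for each $\alpha'\in(0,\alpha)$. Here $d_{\mathcal{H}}(A,B)=\sup_{y\in A}\operatorname{dist}(y,B)+\sup_{z\in B}\operatorname{dist}(z,A)$. *)

(* Defs.v *)
From HB Require Import structures.
From mathcomp Require Import all_boot all_order all_algebra.
From mathcomp Require Import all_classical all_reals all_analysis.
Set Implicit Arguments. Unset Strict Implicit. Unset Printing Implicit Defensive.
Import Order.TTheory GRing.Theory Num.Theory.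
Import numFieldNormedType.Exports.
Local Open Scope classical_set_scope.
Local Open Scope ring_scope.

Section Defs.
Variable R : realType.

Definition enorm (k : nat) (v : 'rV[R]_k) : R := Num.sqrt (\sum_(i < k) v 0 i ^+ 2).

Definition eball (n : nat) (x : 'rV[R]_n) (r : R) : set 'rV[R]_n :=
  [set y | enorm (y - x) < r].
Definition ecball (n : nat) (x : 'rV[R]_n) (r : R) : set 'rV[R]_n :=
  [set y | enorm (y - x) <= r].

(* An m-dimensional linear subspace P of R^n is encoded by a matrix Q whose rows
   form an orthonormal basis of P; xi : 'rV_m are (isometric) coordinates on P,
   xi |-> xi *m Q. *)
Definition orthonormal (m n : nat) (Q : 'M[R]_(m, n)) : Prop := Q *m Q^T = 1%:M.

Definition into_perp (m n : nat) (Q : 'M[R]_(m, n)) (f : 'rV[R]_m -> 'rV[R]_n) :=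
  forall xi, f xi *m Q^T = 0.

Definition graph_at (m n : nat) (x : 'rV[R]_n) (Q : 'M[R]_(m, n))
  (f : 'rV[R]_m -> 'rV[R]_n) : set 'rV[R]_n :=
  [set x + (xi *m Q + f xi) | xi in [set: 'rV[R]_m]].

Definition opnorm_le (m n : nat) (A : 'M[R]_(m, n)) (c : R) : Prop :=
  forall v : 'rV[R]_m, enorm (v *m A) <= c * enorm v.

Definition hasDeriv (m n : nat) (f : 'rV[R]_m -> 'rV[R]_n) (Df : 'rV[R]_m -> 'M[R]_(m, n)) :=
  forall xi (e : R), 0 < e -> exists2 delta : R, 0 < delta &
    forall eta, enorm (eta - xi) < delta ->
      enorm (f eta - f xi - (eta - xi) *m Df xi) <= e * enorm (eta - xi).

Definition locHolder (m n : nat) (Df : 'rV[R]_m -> 'M[R]_(m, n)) (a : R) :=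
  forall K : R, 0 < K -> exists C : R, forall xi eta,
    enorm xi <= K -> enorm eta <= K -> opnorm_le (Df xi - Df eta) (C * enorm (xi - eta) `^ a).

Definition C1a (m n : nat) (f : 'rV[R]_m -> 'rV[R]_n) (Df : 'rV[R]_m -> 'M[R]_(m, n)) (a : R) :=
  hasDeriv f Df /\ locHolder Df a.

Definition C1a_submanifold (m n : nat) (a : R) (S : set 'rV[R]_n) : Prop :=
  forall x, S x -> exists2 r : R, 0 < r &
    exists Q : 'M[R]_(m, n), exists f, exists Df,
      [/\ orthonormal Q, into_perp Q f, C1a f Df a &
          S `&` eball x r = graph_at x Q f `&` eball x r].

Definition classC (m n : nat) (a : R) (S : set 'rV[R]_n) : Prop :=
  compact S /\ C1a_submanifold m a S.

Definition classCRLd (m n : nat) (a Rad L d : R) (S : set 'rV[R]_n) : Prop :=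
  [/\ classC m a S,
      S `<=` ecball 0 d &
      forall x, S x -> exists Q : 'M[R]_(m, n), exists f, exists Df,
        [/\ orthonormal Q, into_perp Q f, hasDeriv f Df,
            S `&` eball x Rad = graph_at x Q f `&` eball x Rad &
            [/\ f 0 = 0, Df 0 = 0,
            (forall xi eta, opnorm_le (Df xi - Df eta) (L * enorm (xi - eta) `^ a)) &
            (forall xi eta, enorm (f xi - f eta) <= enorm (xi - eta))]]].

(* ||g||_{C^{1,a}} <= e, with ||g|| = sup|g| + sup||Dg|| + [Dg]_a (sum of the sups,
   written out over independent points). *)
Definition C1a_norm_le (m n : nat) (g : 'rV[R]_m -> 'rV[R]_n) (Dg : 'rV[R]_m -> 'M[R]_(m, n))
  (a e : R) : Prop :=
  forall (xi1 xi2 xi3 eta3 v w : 'rV[R]_m), xi3 != eta3 -> enorm v <= 1 -> enorm w <= 1 ->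
    enorm (g xi1) + enorm (v *m Dg xi2)
      + enorm (w *m (Dg xi3 - Dg eta3)) / enorm (xi3 - eta3) `^ a <= e.

Definition hausdorff_cvg (n : nat) (S : nat -> set 'rV[R]_n) (S0 : set 'rV[R]_n) : Prop :=
  forall e : R, 0 < e -> exists N : nat, forall j, (N <= j)%N ->
    (forall y, S j y -> exists2 z, S0 z & enorm (y - z) <= e) /\
    (forall z, S0 z -> exists2 y, S j y & enorm (y - z) <= e).

Definition cvgC (m n : nat) (a : R) (S : nat -> set 'rV[R]_n) (S0 : set 'rV[R]_n) : Prop :=
  [/\ hausdorff_cvg S S0,
      C1a_submanifold m a S0 &
      exists j0 : nat, exists2 rho : R, 0 < rho &
        forall x, S0 x -> exists Q : 'M[R]_(m, n),
          exists f0, exists Df0, exists f : nat -> 'rV[R]_m -> 'rV[R]_n,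
          exists Df : nat -> 'rV[R]_m -> 'M[R]_(m, n),
          [/\ orthonormal Q,
              (* f0 describes S0 over its tangent plane T_x S0 = row space of Q *)
              [/\ into_perp Q f0, C1a f0 Df0 a, f0 0 = 0, Df0 0 = 0 &
                  S0 `&` eball x rho = graph_at x Q f0 `&` eball x rho],
              (forall j, (j0 <= j)%N ->
                 [/\ into_perp Q (f j), C1a (f j) (Df j) a &
                     S j `&` eball x rho = graph_at x Q (f j) `&` eball x rho]) &
              (forall a' : R, 0 < a' -> a' < a -> forall e : R, 0 < e ->
                 exists N : nat, forall j, (j0 <= j)%N -> (N <= j)%N ->
                   C1a_norm_le (fun xi => f j xi - f0 xi) (fun xi => Df j xi - Df0 xi) a' e)]].

End Defs.

(* Main.v *)
(** Fix a free ultrafilter [U] on [nat]. Bounded sequences converge along [U],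
    so every limit object is an ultralimit: [S0] is the set of limits of points
    of the [S j], and a chart of [S0] at [x] is the pointwise ultralimit of
    charts of the [S j] at points tending to [x]; the uniform first-order Taylor
    estimate survives this limit, so no equicontinuity argument is needed. The
    Hausdorff distance tends to [0] along [U], hence along a subsequence.

    Once two sets of the class are Hausdorff close, their tangent planes at
    close points are close. Since a chart [f] takes values orthogonal to its own
    plane, its component along a nearby plane has small Lipschitz constant, and
    a global contraction argument rewrites its whole graph over that plane, with
    uniform C^{1,a} bounds. The graph functions over the tangent plane of [S0]
    converge uniformly by Hausdorff convergence; after multiplication by a
    cutoff, interpolation against the Hölder bound gives C^{1,a'}
    convergence. *)

From HB Require Import structures.
From mathcomp Require Import all_boot all_order all_algebra.
From mathcomp Require Import all_classical all_reals all_analysis.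
From mathcomp Require Import ring lra.
Require Import Defs.
Import Order.TTheory GRing.Theory Num.Theory.
Import numFieldNormedType.Exports.
Set Implicit Arguments.
Unset Strict Implicit.
Unset Printing Implicit Defensive.
Local Open Scope classical_set_scope.
Local Open Scope ring_scope.

(** * Euclidean norm and orthonormal frames *)

Section EuclideanNorm.
Variable R : realType.

Lemma enorm_ge0 k (v : 'rV[R]_k) : 0 <= enorm v.
Proof. exact: sqrtr_ge0. Qed.

Lemma enorm_sqr k (v : 'rV[R]_k) : enorm v ^+ 2 = (v *m v^T) 0 0.
Proof.
rewrite sqr_sqrtr; last by apply: sumr_ge0 => i _; exact: sqr_ge0.
by rewrite mxE; apply: eq_bigr => i _; rewrite mxE expr2.
Qed.

Lemma enorm0 k : enorm (0 : 'rV[R]_k) = 0.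
Proof.
by apply/eqP; rewrite -sqrf_eq0 enorm_sqr mul0mx mxE.
Qed.

Lemma enorm_eq0 k (v : 'rV[R]_k) : enorm v = 0 -> v = 0.
Proof.
move=> /eqP; rewrite sqrtr_eq0 => v0.
have : \sum_(i < k) v 0 i ^+ 2 == 0.
  by rewrite eq_le v0/=; apply: sumr_ge0 => i _; exact: sqr_ge0.
rewrite psumr_eq0 => [/allP v00|i _]; last exact: sqr_ge0.
apply/rowP => i; rewrite mxE; apply/eqP; rewrite -sqrf_eq0.
exact: (implyP (v00 i (mem_index_enum _))).
Qed.

Lemma enorm_gt0 k (v : 'rV[R]_k) : v != 0 -> 0 < enorm v.
Proof.
move=> v0; rewrite lt_neqAle enorm_ge0 andbT eq_sym.
by apply: contra_neq v0 => /enorm_eq0.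
Qed.

Lemma enormZ k c (v : 'rV[R]_k) : enorm (c *: v) = `|c| * enorm v.
Proof.
apply/eqP; rewrite -(@eqrXn2 _ 2) ?enorm_ge0 ?mulr_ge0 ?enorm_ge0 //.
by rewrite exprMn real_normK ?num_real// !enorm_sqr linearZ/= -scalemxAl
  -scalemxAr !mxE mulrA expr2.
Qed.

Lemma enormN k (v : 'rV[R]_k) : enorm (- v) = enorm v.
Proof. by rewrite -scaleN1r enormZ normrN normr1 mul1r. Qed.

Lemma enorm_distC k (u v : 'rV[R]_k) : enorm (u - v) = enorm (v - u).
Proof. by rewrite -enormN opprB. Qed.

Lemma mulmxC00 k (u v : 'rV[R]_k) : (u *m v^T) 0 0 = (v *m u^T) 0 0.
Proof. by rewrite -{1}[u]trmxK -trmx_mul mxE. Qed.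

Lemma enorm_sqrD k (u v : 'rV[R]_k) :
  enorm (u + v) ^+ 2 = enorm u ^+ 2 + 2 * (u *m v^T) 0 0 + enorm v ^+ 2.
Proof.
rewrite !enorm_sqr linearD/= mulmxDl !mulmxDr.
have -> : forall A B C D : 'M[R]_1, (A + B + (C + D)) 0 0 =
  A 0 0 + B 0 0 + (C 0 0 + D 0 0) by move=> A B C D; rewrite !mxE.
by rewrite (mulmxC00 v u); ring.
Qed.

Lemma cauchy_schwarz k (u v : 'rV[R]_k) : (u *m v^T) 0 0 <= enorm u * enorm v.
Proof.
have [->|/enorm_gt0 u0] := eqVneq u 0; first by rewrite mul0mx mxE enorm0 mul0r.
have [->|/enorm_gt0 v0] := eqVneq v 0.
  by rewrite trmx0 mulmx0 mxE enorm0 mulr0.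
have := sqr_ge0 (enorm (enorm v *: u + (- enorm u) *: v)).
rewrite enorm_sqrD !enormZ -scalemxAl linearZ/= -scalemxAr !mxE normrN.
rewrite !ger0_norm ?enorm_ge0//.
set a := enorm u; set b := enorm v; set c := \sum_i _ => h.
have : 0 <= a * b * (a * b - c) by nra.
by rewrite pmulr_rge0 ?mulr_gt0// subr_ge0.
Qed.

Lemma ler_enormD k (u v : 'rV[R]_k) : enorm (u + v) <= enorm u + enorm v.
Proof.
rewrite -(@ler_pXn2r _ 2) ?nnegrE ?addr_ge0 ?enorm_ge0//.
rewrite enorm_sqrD; have := cauchy_schwarz u v; nra.
Qed.

Lemma ler_enormB k (u v : 'rV[R]_k) : enorm (u - v) <= enorm u + enorm v.
Proof. by rewrite -(enormN v) ler_enormD. Qed.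

Lemma ler_enorm_dist k (w u v : 'rV[R]_k) :
  enorm (u - v) <= enorm (u - w) + enorm (w - v).
Proof.
have -> : u - v = (u - w) + (w - v) by rewrite addrA subrK.
exact: ler_enormD.
Qed.

Lemma ler_enorm_sub k (u v : 'rV[R]_k) : enorm u - enorm v <= enorm (u - v).
Proof. by rewrite lerBlDr -{1}(subrK v u) ler_enormD. Qed.

Lemma ler_entry_enorm k (v : 'rV[R]_k) i : `|v 0 i| <= enorm v.
Proof.
rewrite -(@ler_pXn2r _ 2) ?nnegrE ?enorm_ge0// real_normK ?num_real//.
rewrite sqr_sqrtr; last by apply: sumr_ge0 => j _; exact: sqr_ge0.
by rewrite (bigD1 i)//= lerDl; apply: sumr_ge0 => j _; exact: sqr_ge0.
Qed.

Section Orthonormal.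
Variables (m n : nat) (Q : 'M[R]_(m, n)).
Hypothesis oQ : orthonormal Q.

Lemma mulmx_orthoK (v : 'rV[R]_m) : v *m Q *m Q^T = v.
Proof. by rewrite -mulmxA oQ mulmx1. Qed.

Lemma enorm_ortho (v : 'rV[R]_m) : enorm (v *m Q) = enorm v.
Proof.
apply/eqP; rewrite -(@eqrXn2 _ 2) ?enorm_ge0//.
by rewrite !enorm_sqr trmx_mul mulmxA mulmx_orthoK.
Qed.

Lemma ler_enorm_orthoT (w : 'rV[R]_n) : enorm (w *m Q^T) <= enorm w.
Proof.
set u := w *m Q^T.
have : enorm u ^+ 2 <= enorm w * enorm u.
  rewrite -(enorm_ortho u) (enorm_sqr (u *m Q)).
  by rewrite trmx_mul mulmxA mulmx_orthoK -[u in u *m _]/(w *m Q^T) -mulmxA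
     -trmx_mul cauchy_schwarz.
have := enorm_ge0 u; have := enorm_ge0 w; nra.
Qed.

Lemma enorm_proj (w : 'rV[R]_n) :
  enorm w ^+ 2 = enorm (w *m Q^T) ^+ 2 + enorm (w - w *m Q^T *m Q) ^+ 2.
Proof.
rewrite !enorm_sqr [in RHS]linearB/= mulmxBl !mulmxBr !trmx_mul trmxK !mulmxA.
rewrite !mulmx_orthoK subrr subr0.
by rewrite [(w *m w^T - _) _ _]mxE [X in _ + (_ + X)]mxE addrC subrK.
Qed.

End Orthonormal.

End EuclideanNorm.

(** * Mean value inequality, Taylor bounds and Hölder derivatives *)

Section Derivatives.
Variable R : realType.

Lemma is_derive_eps (phi : R -> R) (t l : R) :
  (forall e, 0 < e -> exists2 delta, 0 < delta &
     forall h, `|h| < delta -> `|phi (t + h) - phi t - h * l| <= e * `|h|) ->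
  is_derive t 1 phi l.
Proof.
move=> H.
have C : h^-1 *: (phi (h *: (1:R) + t) - phi t) @[h --> 0^'] --> l.
  apply/cvgrPdist_le => e e0; have [d d0 Hd] := H e e0.
  near=> h.
  have h0 : h != 0 by near: h; exact: nbhs_dnbhs_neq.
  have hd : `|h| < d by near: h; exact: dnbhs0_lt.
  have := Hd h hd; rewrite [h *: 1]mulr1 (addrC h) => Hh.
  have -> : l - h^-1 *: (phi (t + h) - phi t) =
     - (h^-1 * (phi (t + h) - phi t - h * l)).
    by rewrite /GRing.scale/=; field.
  by rewrite normrN normrM normfV mulrC ler_pdivrMr ?normr_gt0.
split; first by apply: cvgP C.
by apply: cvg_lim C.
Unshelve. all: by end_near. Qed.

Lemma ler_norm_dot k (u v : 'rV[R]_k) : `|(u *m v^T) 0 0| <= enorm u * enorm v.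
Proof.
rewrite ler_norml cauchy_schwarz andbT lerNl.
have -> : - (u *m v^T) 0 0 = ((- u) *m v^T) 0 0 by rewrite mulNmx [RHS]mxE.
by rewrite -(enormN u) cauchy_schwarz.
Qed.

(** Pairing with the error vector [w] itself reduces this to the one-variable mean value theorem for
    [phi]: it yields |w|^2 = <v (Df z - B), w> at some [z] on the segment, and Cauchy-Schwarz lets
    one factor |w| cancel. *)
Lemma mean_value m n (f : 'rV[R]_m -> 'rV[R]_n) Df (xi eta : 'rV[R]_m)
    (B : 'M[R]_(m, n)) (c : R) :
  hasDeriv f Df ->
  (forall z, enorm (z - xi) <= enorm (eta - xi) -> opnorm_le (Df z - B) c) ->
  enorm (f eta - f xi - (eta - xi) *m B) <= c * enorm (eta - xi).
Proof.
move=> fD HB; set v : 'rV[R]_m := eta - xi; set w : 'rV[R]_n := _ - v *m B.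
pose dot (u : 'rV[R]_n) : R := (u *m w^T) 0 0.
have dotB u u' : dot u - dot u' = dot (u - u') by rewrite /dot mulmxBl !mxE.
have dotZ (x : R) u : x * dot u = dot (x *: u).
  by rewrite /dot -scalemxAl [RHS]mxE.
pose phi (t : R) : R := dot (f (xi + t *: v) - t *: (v *m B)).
pose dphi (t : R) : R := dot (v *m (Df (xi + t *: v) - B)).
have D (t : R) : is_derive t 1 phi (dphi t).
  apply: is_derive_eps => e e0.
  have p0 : 0 < 1 + enorm v * enorm w.
    by rewrite ltr_pwDl ?mulr_ge0 ?enorm_ge0.
  have [d d0 Hd] := fD (xi + t *: v) _ (divr_gt0 e0 p0).
  have q0 : 0 < 1 + enorm v by rewrite ltr_pwDl ?enorm_ge0.
  exists (d / (1 + enorm v)); first exact: divr_gt0.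
  move=> h; rewrite ltr_pdivlMr// => hd.
  have -> : phi (t + h) - phi t - h * dphi t =
    dot (f (xi + (t + h) *: v) - f (xi + t *: v) - (h *: v) *m Df (xi + t *: v)).
    rewrite /phi /dphi dotZ !dotB; congr dot.
    rewrite mulmxBr scalerBr -!scalemxAl scalerDl.
    by apply/rowP => i; rewrite !mxE; ring.
  apply: le_trans (ler_norm_dot _ _) _.
  have hv : xi + (t + h) *: v - (xi + t *: v) = h *: v.
    by rewrite scalerDl; apply/rowP => i; rewrite !mxE; ring.
  have := Hd (xi + (t + h) *: v); rewrite hv enormZ => H.
  have {}H := H (le_lt_trans (ler_wpM2l (normr_ge0 h) _) hd).
  have {}H := H (ler_wpDl ler01 (lexx _)).
  apply: (@le_trans _ _
    (e / (1 + enorm v * enorm w) * (`|h| * enorm v) * enorm w)).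
    by rewrite ler_wpM2r ?enorm_ge0.
  have -> : e / (1 + enorm v * enorm w) * (`|h| * enorm v) * enorm w =
    e * `|h| * (enorm v * enorm w / (1 + enorm v * enorm w)).
    by field; rewrite gt_eqF.
  rewrite ler_piMr ?mulr_ge0// ?(ltW e0)// ler_pdivrMr// mul1r; lra.
have cphi : {within `[(0 : R), 1], continuous phi}.
  by apply: derivable_within_continuous => x _; have [] := D x.
have [t] := MVT ltr01 (fun x _ => D x) cphi.
rewrite in_itv/= => /andP[t0 t1].
rewrite subr0 mulr1.
have -> : phi 1 - phi 0 = enorm w ^+ 2.
  rewrite /phi !scale1r !scale0r subr0 addr0.
  rewrite dotB enorm_sqr /dot; congr ((_ *m _) 0 0).
  by rewrite addrCA subrr addr0 addrAC.
move=> E.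
have : enorm w ^+ 2 <= c * enorm v * enorm w.
  rewrite E; apply: le_trans (cauchy_schwarz _ _) _.
  rewrite ler_wpM2r ?enorm_ge0//; apply: HB.
  rewrite addrAC subrr add0r enormZ ger0_norm ?(ltW t0)//.
  by rewrite ler_piMl ?enorm_ge0// ltW.
have [->|w0] := eqVneq w 0.
  move=> _; rewrite enorm0; apply: le_trans (enorm_ge0 _) (HB xi _ v).
  by rewrite subrr enorm0 enorm_ge0.
by rewrite expr2 ler_pM2r// enorm_gt0.
Qed.

(** A Lipschitz bound passes to the derivative through difference quotients. The factor [B] allows
    bounding only one component of the derivative; it is used with the identity and with the
    projection [Q^T]. *)
Lemma deriv_opnorm_le m n p (f : 'rV[R]_m -> 'rV[R]_n) Df xi
    (B : 'M[R]_(n, p)) (c : R) :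
  hasDeriv f Df -> opnorm_le B 1 ->
  (forall eta, enorm ((f eta - f xi) *m B) <= c * enorm (eta - xi)) ->
  opnorm_le (Df xi *m B) c.
Proof.
move=> fD B1 fB v.
have [->|v0] := eqVneq v 0; first by rewrite mul0mx !enorm0 mulr0.
have {}v0 := enorm_gt0 v0.
apply/ler_addgt0Pr => e e0.
have [d d0 Hd] := fD xi (e / enorm v) (divr_gt0 e0 v0).
(* This scale gives [t *: v] length [d / 2], inside the range of the derivative estimate; the
   tolerance [e / enorm v] becomes exactly [e] after division by [t]. *)
pose t := d / 2 / enorm v.
have t0 : 0 < t by rewrite !divr_gt0.
have tE : enorm (t *: v) = d / 2.
  by rewrite enormZ gtr0_norm// divfK// gt_eqF.
have := Hd (xi + t *: v); have := fB (xi + t *: v).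
rewrite addrAC subrr add0r tE => H1 H2.
have {}H2 : _ := H2 _; rewrite ltr_pdivrMr// mulr_natr mulr2n ltrDl in H2.
have {}H2 := H2 d0.
set E := _ - (t *: v) *m _ in H2.
have K : (t *: v) *m (Df xi *m B) = (f (xi + t *: v) - f xi) *m B - E *m B.
  by rewrite -mulmxBl /E opprB addrC subrK mulmxA.
have : t * enorm (v *m (Df xi *m B)) <= c * (d / 2) + e / enorm v * (d / 2).
  rewrite -[t in t * _]gtr0_norm// -enormZ scalemxAl K.
  apply: le_trans (ler_enormB _ _) _; apply: lerD => //.
  by apply: le_trans (B1 _) _; rewrite mul1r.
have -> : c * (d / 2) + e / enorm v * (d / 2) = t * (c * enorm v + e).
  by rewrite /t; field; rewrite gt_eqF.
by rewrite ler_pM2l.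
Qed.

(** A remainder of order 1 + a is o(|eta - xi|). The constant may depend on the base point and the
    bound is asked only at distance at most 1, which is what products with a cutoff provide. *)
Lemma hasDeriv_powR m n (f : 'rV[R]_m -> 'rV[R]_n) Df (a : R) : 0 < a ->
  (forall xi, exists C, forall eta, enorm (eta - xi) <= 1 ->
     enorm (f eta - f xi - (eta - xi) *m Df xi) <=
       C * enorm (eta - xi) `^ a * enorm (eta - xi)) ->
  hasDeriv f Df.
Proof.
move=> a0 H xi e e0; have [C HC] := H xi.
have C0 : 0 < 1 + `|C| by rewrite ltr_pwDl.
pose s := (e / (1 + `|C|)) `^ a^-1.
have s0 : 0 < s by rewrite powR_gt0// divr_gt0.
exists (Num.min 1 s); first by rewrite lt_min ltr01.
move=> eta; rewrite lt_min => /andP[/ltW h1 hs].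
apply: le_trans (HC _ h1) _; rewrite ler_wpM2r ?enorm_ge0//.
have : enorm (eta - xi) `^ a <= e / (1 + `|C|).
  have -> : e / (1 + `|C|) = s `^ a.
    by rewrite /s -powRrM mulVf ?gt_eqF// powRr1// ltW// divr_gt0.
  by rewrite ge0_ler_powR ?nnegrE ?enorm_ge0 ?ltW.
rewrite ler_pdivlMr// => h.
apply: le_trans h; rewrite mulrC ler_wpM2l ?powR_ge0//.
by apply: le_trans (ler_norm _) _; rewrite lerDr.
Qed.

Lemma exists_powR_le (a c b : R) : 0 < a -> 0 < c -> 0 < b ->
  exists2 s : R, 0 < s <= b & forall t, 0 <= t <= s -> t `^ a <= c.
Proof.
move=> a0 c0 b0; exists (Num.min b (c `^ a^-1)).
  by rewrite lt_min b0 powR_gt0// ge_min lexx.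
move=> t /andP[t0]; rewrite le_min => /andP[_ tc].
have -> : c = (c `^ a^-1) `^ a.
  by rewrite -powRrM mulVf ?gt_eqF// powRr1// ltW.
by rewrite ge0_ler_powR ?nnegrE ?powR_ge0 ?(ltW a0).
Qed.

Definition holder m n (F : 'rV[R]_m -> 'M[R]_(m, n)) (L a : R) :=
  forall xi eta, opnorm_le (F xi - F eta) (L * enorm (xi - eta) `^ a).

(** Mean value inequality with [B] the derivative at [xi]. The bound involves only finitely many
    values of [f] and [Df], so it survives pointwise limits. *)
Lemma holder_taylor m n (f : 'rV[R]_m -> 'rV[R]_n) Df (L a : R) xi eta :
  0 < a -> 0 <= L -> hasDeriv f Df -> holder Df L a ->
  enorm (f eta - f xi - (eta - xi) *m Df xi) <=
    L * enorm (eta - xi) `^ a * enorm (eta - xi).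
Proof.
move=> a0 L0 fD fL; apply: (mean_value fD) => z zle v.
apply: le_trans (fL _ _ _) _; rewrite ler_wpM2r ?enorm_ge0// ler_wpM2l//.
by rewrite ge0_ler_powR ?nnegrE ?enorm_ge0 ?(ltW a0).
Qed.

End Derivatives.

(** * Entrywise convergence of matrices along a filter *)

Definition mcvg (R : realType) T (F : set_system T) p q
    (u : T -> 'M[R]_(p, q)) (l : 'M[R]_(p, q)) :=
  forall i k, u t i k @[t --> F] --> l i k.

Section EntrywiseLimits.
Context {R : realType} {T : Type} {F : set_system T} {PF : ProperFilter F}.

Lemma mcvg_cst p q (l : 'M[R]_(p, q)) : mcvg F (fun=> l) l.
Proof. by move=> i k; exact: cvg_cst. Qed.

Lemma mcvgD p q (u v : T -> 'M[R]_(p, q)) l k :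
  mcvg F u l -> mcvg F v k -> mcvg F (fun t => u t + v t) (l + k).
Proof.
move=> ul vk i j; rewrite mxE; under eq_cvg do rewrite mxE.
exact: (cvgD (ul i j) (vk i j)).
Qed.

Lemma mcvgB p q (u v : T -> 'M[R]_(p, q)) l k :
  mcvg F u l -> mcvg F v k -> mcvg F (fun t => u t - v t) (l - k).
Proof.
move=> ul vk i j; rewrite !mxE; under eq_cvg do rewrite !mxE.
exact: (cvgB (ul i j) (vk i j)).
Qed.

Lemma cvg_sum_ord k (f : 'I_k -> T -> R) (l : 'I_k -> R) :
  (forall i, f i t @[t --> F] --> l i) ->
  \sum_(i < k) f i t @[t --> F] --> \sum_(i < k) l i.
Proof.
by move=> fl; apply: cvg_big => //; exact: add_continuous.
Qed.

Lemma mcvgM p q r (u : T -> 'M[R]_(p, q)) (v : T -> 'M[R]_(q, r)) l k :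
  mcvg F u l -> mcvg F v k -> mcvg F (fun t => u t *m v t) (l *m k).
Proof.
move=> ul vk i j; rewrite mxE; under eq_cvg do rewrite mxE.
apply: (@cvg_sum_ord _ (fun h t => u t i h * v t h j)) => h.
exact: (cvgM (ul i h) (vk h j)).
Qed.

Lemma mcvgT p q (u : T -> 'M[R]_(p, q)) l :
  mcvg F u l -> mcvg F (fun t => (u t)^T) l^T.
Proof.
by move=> ul i j; rewrite mxE; under eq_cvg do rewrite mxE; exact: ul.
Qed.

Lemma mcvg_enorm p (u : T -> 'rV[R]_p) l :
  mcvg F u l -> enorm (u t) @[t --> F] --> enorm l.
Proof.
move=> ul; apply: (@continuous_cvg _ _ _ _ _ _ Num.sqrt).
  exact: sqrt_continuous.
apply: (@cvg_sum_ord _ (fun i t => u t 0 i ^+ 2)) => i.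
rewrite expr2; under eq_cvg do rewrite expr2.
exact: (cvgM (ul 0 i) (ul 0 i)).
Qed.

Lemma mcvg_lt p (u : T -> 'rV[R]_p) l e :
  mcvg F u l -> enorm l < e -> \forall t \near F, enorm (u t) < e.
Proof. by move=> /mcvg_enorm ul le; exact: (cvgr_lt _ ul). Qed.

Lemma mcvg_dist p (u : T -> 'rV[R]_p) l e :
  mcvg F u l -> 0 < e -> \forall t \near F, enorm (u t - l) < e.
Proof.
move=> ul e0; have := mcvgB ul (@mcvg_cst _ _ l).
by rewrite subrr => /(@mcvg_lt _ _ _ e); apply; rewrite enorm0.
Qed.

Lemma dist_mcvg p (u : T -> 'rV[R]_p) l :
  (forall e, 0 < e -> \forall t \near F, enorm (u t - l) < e) -> mcvg F u l.
Proof.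
move=> ul i k; rewrite (ord1 i); apply/cvgrPdist_lt => e e0.
apply: filterS (ul e e0) => t; apply: le_lt_trans.
by rewrite distrC; have := ler_entry_enorm (u t - l) k; rewrite !mxE.
Qed.

Lemma mcvg_le p (u : T -> 'rV[R]_p) l c :
  mcvg F u l -> (\forall t \near F, enorm (u t) <= c) -> enorm l <= c.
Proof. by move=> /mcvg_enorm ul uc; apply: cvgr_to_le ul uc. Qed.

Lemma ler_cvg_filter (f g : T -> R) l k : f t @[t --> F] --> l ->
  g t @[t --> F] --> k -> (\forall t \near F, f t <= g t) -> l <= k.
Proof.
move=> fl gk fg; rewrite -subr_ge0; apply: cvgr_to_ge (cvgB gk fl) _.
by apply: filterS fg => t; rewrite subr_ge0.
Qed.

Lemma mcvg_le2 p q (u : T -> 'rV[R]_p) (v : T -> 'rV[R]_q) l k :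
  mcvg F u l -> mcvg F v k ->
  (\forall t \near F, enorm (u t) <= enorm (v t)) -> enorm l <= enorm k.
Proof.
by move=> /mcvg_enorm ul /mcvg_enorm vk; exact: (ler_cvg_filter ul vk).
Qed.

Lemma mcvg_unique p q (u v : T -> 'M[R]_(p, q)) l k :
  mcvg F u l -> mcvg F v k -> (\forall t \near F, u t = v t) -> l = k.
Proof.
move=> ul vk uv; apply/matrixP => i j; apply/eqP; rewrite eq_le; apply/andP.
by split; [apply: ler_cvg_filter (ul i j) (vk i j) _|
           apply: ler_cvg_filter (vk i j) (ul i j) _]; apply: filterS uv => t ->.
Qed.

End EntrywiseLimits.
Arguments mcvg_cst {R T F PF p q} l.

(** * Ultralimits of bounded families, and compactness *)

Section UltrafilterLimits.
Context {R : realType} {T : Type} {U : set_system T} {UF : UltraFilter U}.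

(** The image ultrafilter contains a compact interval, hence has a cluster point, and an ultrafilter
    converges to each of its cluster points. *)
Lemma ultra_cvg_bounded (u : T -> R) (M : R) :
  (\forall t \near U, `|u t| <= M) -> exists l : R, u t @[t --> U] --> l.
Proof.
move=> uM.
have G : (u @ U) `[- M, M]%classic.
  by apply: filterS uM => t /=; rewrite in_itv/= ler_norml.
have [l [_ Gl]] := segment_compact _ G.
exists l => B lB; have [//|H] := in_ultra_setVsetC (u @^-1` B) UF.
by have [y []] := Gl (~` B) B H lB.
Qed.

Lemma ultra_mcvg p q (u : T -> 'M[R]_(p, q)) (M : R) :
  (\forall t \near U, forall i k, `|u t i k| <= M) -> exists l, mcvg U u l.
Proof.
move=> uM.
have /choice[l Hl] : forall ik : 'I_p * 'I_q, exists l : R,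
    u t ik.1 ik.2 @[t --> U] --> l.
  by move=> ik; apply: (@ultra_cvg_bounded _ M); apply: filterS uM => t; exact.
by exists (\matrix_(i, k) l (i, k)) => i k; rewrite mxE; exact: (Hl (i, k)).
Qed.

Lemma ultra_mcvg_row p (u : T -> 'rV[R]_p) (M : R) :
  (\forall t \near U, enorm (u t) <= M) -> exists l, mcvg U u l.
Proof.
move=> uM; apply: (@ultra_mcvg _ _ _ M); apply: filterS uM => t uM i k.
by rewrite (ord1 i); exact: le_trans (ler_entry_enorm _ _) uM.
Qed.

Lemma ultra_mcvg_opnorm p q (u : T -> 'M[R]_(p, q)) (M : R) :
  (\forall t \near U, opnorm_le (u t) M) -> exists l, mcvg U u l.
Proof.
move=> uM; apply: (@ultra_mcvg _ _ _ `|M|); apply: filterS uM => t uM i k.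
have d1 : enorm (delta_mx 0 i : 'rV[R]_p) = 1.
  apply/eqP; rewrite -(@eqrXn2 _ 2) ?enorm_ge0// enorm_sqr trmx_delta.
  by rewrite mul_delta_mx mxE !eqxx expr1n.
have := uM (delta_mx 0 i); rewrite -rowE d1 mulr1 => H.
have := le_trans (ler_entry_enorm _ k) H; rewrite mxE => {}H.
exact: le_trans H (ler_norm _).
Qed.

End UltrafilterLimits.

(** Heine-Borel through ultrafilters: boundedness gives an entrywise limit and closedness puts it in
    [A]. Entrywise convergence is then translated into convergence for the uniform structure of
    matrices. *)
Lemma bounded_closed_ecompact (R : realType) n (A : set 'rV[R]_n) (d : R) :
  A `<=` ecball 0 d ->
  (forall x, (forall e, 0 < e -> exists2 z, A z & enorm (z - x) < e) -> A x) ->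
  compact A.
Proof.
move=> Ad Acl; rewrite compact_ultra => F FU FA.
have [|l Fl] := @ultra_mcvg_row R _ F FU _ id d.
  by apply: filterS FA => x /Ad; rewrite /ecball/= subr0.
exists l; split.
  apply: Acl => e e0.
  have [z [Az ze]] := filter_ex (filterI FA (mcvg_dist Fl e0)).
  by exists z.
apply/cvg_mx_entourageP => A' eA'.
apply: filter_forall => i; apply: filter_forall => k.
have H : F _ := Fl i k _ (nbhs_entourage (l i k) eA').
by apply: filterS H => N; rewrite /xsection/= inE.
Qed.

(** The graph clause of [classCRLd] at a single point, isolated because it is the condition that
    passes to the limit. *)
Definition chart (R : realType) m n (Rad L a : R) (S : set 'rV[R]_n)
    (x : 'rV[R]_n) (Q : 'M[R]_(m, n)) (f : 'rV[R]_m -> 'rV[R]_n)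
    (Df : 'rV[R]_m -> 'M[R]_(m, n)) :=
  [/\ orthonormal Q, into_perp Q f, hasDeriv f Df,
      S `&` eball x Rad = graph_at x Q f `&` eball x Rad &
      [/\ f 0 = 0, Df 0 = 0, holder Df L a &
          forall xi eta, enorm (f xi - f eta) <= enorm (xi - eta)]].

Definition hausdorff_le (R : realType) n (A B : set 'rV[R]_n) (e : R) :=
  (forall y, A y -> exists2 z, B z & enorm (y - z) <= e) /\
  (forall z, B z -> exists2 y, A y & enorm (y - z) <= e).

Lemma exists_almost_nearest (R : realType) n (A : set 'rV[R]_n) x (e : R) :
  A !=set0 -> 0 < e ->
  exists2 y, A y & forall z, A z -> enorm (y - x) < enorm (z - x) + e.
Proof.
move=> [z0 Az0] e0; pose E := [set enorm (z - x) | z in A].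
have hE : has_inf E.
  split; first by exists (enorm (z0 - x)), z0.
  by exists 0 => _ [z _ <-]; exact: enorm_ge0.
have [_ [y Ay <-] yE] := inf_adherent e0 hE.
exists y => // z Az; apply: lt_le_trans yE _; rewrite lerD2r.
by apply: inf_lbound; [case: hE|exists z].
Qed.

(** * The ultralimit of a sequence of bounded sets *)

Section UltraLimit.
Variables (R : realType) (n : nat) (S : nat -> set 'rV[R]_n) (d : R).
Variable U : set_system nat.
Hypotheses (UF : UltraFilter U) (Uoo : \oo `<=` U).
Hypothesis Sd : forall j, S j `<=` ecball 0 d.

Definition ulimset : set 'rV[R]_n :=
  [set x | forall e, 0 < e -> U [set j | exists2 y, S j y & enorm (y - x) < e]].

Lemma ulimset_closed x :
  (forall e, 0 < e -> exists2 z, ulimset z & enorm (z - x) < e) -> ulimset x.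
Proof.
move=> H e e0; have e2 : 0 < e / 2 by rewrite divr_gt0.
have [z Sz zx] := H _ e2; apply: filterS (Sz _ e2) => j [y Sy yz].
exists y => //; apply: le_lt_trans (ler_enorm_dist z _ _) _; lra.
Qed.

Lemma ulimset_mcvg (y : nat -> 'rV[R]_n) x :
  (\forall j \near U, S j (y j)) -> mcvg U y x -> ulimset x.
Proof.
move=> Sy yx e e0.
by apply: filterS (filterI Sy (mcvg_dist yx e0)) => j [] /= ? ?; exists (y j).
Qed.

(** Taking in each [S j] a point nearest to [x] up to 1 / (j + 1) gives one sequence that serves
    every [e], since this tolerance tends to 0 along [U]. *)
Lemma ulimset_seq x : ulimset x ->
  exists y : nat -> 'rV[R]_n, (\forall j \near U, S j (y j)) /\ mcvg U y x.
Proof.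
move=> Sx.
have /choice[y Hy] : forall j, exists y, S j !=set0 ->
    S j y /\ forall z, S j z -> enorm (y - x) < enorm (z - x) + j.+1%:R^-1.
  move=> j; have [S0|S0] := pselect (S j !=set0); last by exists 0.
  have [|y Sy Hy] := @exists_almost_nearest R n (S j) x j.+1%:R^-1 S0.
    by rewrite invr_gt0.
  by exists y.
exists y; split.
  by apply: filterS (Sx 1 ltr01) => j [z Sz _]; apply: (Hy j _).1; exists z.
apply: dist_mcvg => e e0; have e2 : 0 < e / 2 by rewrite divr_gt0.
have H : \forall j \near U, j.+1%:R^-1 < e / 2 
  by apply: Uoo; exact: near_infty_natSinv_lt (PosNum e2).
apply: filterS (filterI H (Sx _ e2)) => j [] /= je [z Sz zx].
have [|_ /(_ z Sz)] := Hy j; first by exists z.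
by move=> h; apply: lt_trans h _; rewrite [e]splitr ltrD.
Qed.

Lemma ulimset_bounded : ulimset `<=` ecball 0 d.
Proof.
move=> x /ulimset_seq[y [Sy yx]]; rewrite /ecball/= subr0.
apply: (mcvg_le yx); apply: filterS Sy => j /Sd.
by rewrite /ecball/= subr0.
Qed.

(** If one of the two inclusions failed, it would fail on a set of [U]. The bounded witnesses then
    converge along [U], and their limit lies in [ulimset], which contradicts their distance from the
    other set. *)
Lemma ulimset_hausdorff e : 0 < e ->
  \forall j \near U, hausdorff_le (S j) ulimset e.
Proof.
move=> e0; apply: filterI.
  have [//|H] := in_ultra_setVsetC
    [set j | forall y, S j y -> exists2 z, ulimset z & enorm (y - z) <= e] UF.
  have /choice[y Hy] : forall j, exists y, ~ (forall y, S j y ->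
      exists2 z, ulimset z & enorm (y - z) <= e) ->
      S j y /\ forall z, ulimset z -> ~ enorm (y - z) <= e.
    move=> j; have [N|N] := pselect (forall y, S j y ->
      exists2 z, ulimset z & enorm (y - z) <= e); first by exists 0.
    have /existsNP[y /not_implyP[Sy /forall2NP Ny]] := N.
    by exists y => _; split => // z Sz; have [] := Ny z.
  have Sy : \forall j \near U, S j (y j).
    by apply: filterS H => j Nj; have [] := Hy j Nj.
  have [|z yz] := @ultra_mcvg_row R _ U UF _ y d.
    by apply: filterS Sy => j /Sd; rewrite /ecball/= subr0.
  have Sz := ulimset_mcvg Sy yz.
  have [j [Nj yj]] := filter_ex (filterI H (mcvg_dist yz e0)).
  by have [_ /(_ z Sz)] := Hy j Nj; rewrite (ltW yj).
(* Here the witnesses lie in [ulimset], so their limit [x] does by closedness; half of [e] is spent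
   from the witness to [x], half from [x] to a point of [S j]. *)
have [//|H] := in_ultra_setVsetC
  [set j | forall z, ulimset z -> exists2 y, S j y & enorm (y - z) <= e] UF.
have /choice[z Hz] : forall j, exists z, ~ (forall z, ulimset z ->
    exists2 y, S j y & enorm (y - z) <= e) ->
    ulimset z /\ forall y, S j y -> ~ enorm (y - z) <= e.
  move=> j; have [N|N] := pselect (forall z, ulimset z ->
    exists2 y, S j y & enorm (y - z) <= e); first by exists 0.
  have /existsNP[z /not_implyP[Sz /forall2NP Nz]] := N.
  by exists z => _; split => // y Sy; have [] := Nz y.
have [|x zx] := @ultra_mcvg_row R _ U UF _ z d.
  apply: filterS H => j Nj; have [+ _] := Hz j Nj.
  by move=> /ulimset_bounded; rewrite /ecball/= subr0.
have e2 : 0 < e / 2 by rewrite divr_gt0.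
have Sx : ulimset x.
  apply: ulimset_closed => e' e'0.
  have [j [Nj zj]] := filter_ex (filterI H (mcvg_dist zx e'0)).
  by have [? _] := Hz j Nj; exists (z j).
have [j [[Nj zj] [y Sy yx]]] :=
  filter_ex (filterI (filterI H (mcvg_dist zx e2)) (Sx _ e2)).
have [_ /(_ y Sy)] := Hz j Nj; case.
apply: le_trans (ler_enorm_dist x _ _) _.
rewrite (enorm_distC x); move: zj yx => /=; lra.
Qed.

(** Each [D i] meets every tail of the integers because [U] contains the tails, so the indices can
    be chosen recursively, each beyond the previous one. *)
Lemma ultra_subseq (D : nat -> set nat) : (forall i, U (D i)) ->
  exists phi : nat -> nat, (forall i, (phi i < phi i.+1)%N) /\
    forall i, D i (phi i).
Proof.
move=> UD.
have /choice[g Hg] : forall ik : nat * nat, exists j, (ik.2 < j)%N /\ D ik.1 j.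
  move=> [i k]; have Uk : U [set j | (k < j)%N] by apply: Uoo; exists k.+1.
  by have [j [kj Dj]] := filter_ex (filterI Uk (UD i)); exists j.
pose phi := fix phi i := if i is i'.+1 then g (i, phi i') else g (0%N, 0%N).
exists phi; split=> [i|[|i]].
- exact: (Hg (i.+1, phi i)).1.
- exact: (Hg (0%N, 0%N)).2.
- exact: (Hg (i.+1, phi i)).2.
Qed.

End UltraLimit.

(** * Charts of the limit set as ultralimits of charts *)

Section ChartLimit.
Variables (R : realType) (m n : nat) (Rad L a : R) (S : nat -> set 'rV[R]_n).
Variable U : set_system nat.
Hypotheses (UF : UltraFilter U) (Uoo : \oo `<=` U) (a0 : 0 < a) (L0 : 0 <= L).
Hypothesis Sc : forall j x, S j x ->
  exists (Q : 'M[R]_(m, n)) f Df, chart Rad L a (S j) x Q f Df.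

(** The frames, graph functions and derivatives are bounded at each fixed argument, so they converge
    pointwise along [U]. The algebraic and metric clauses are closed conditions; differentiability
    and the graph identity are argued separately. *)
Lemma ulimset_chart x : ulimset S U x ->
  exists (Q : 'M[R]_(m, n)) f Df, chart Rad L a (ulimset S U) x Q f Df.
Proof.
move=> Sx; have [y [Sy yx]] := ulimset_seq UF Uoo Sx.
have /choice[c Hc] : forall j, exists c : 'M[R]_(m, n) *
    ('rV[R]_m -> 'rV[R]_n) * ('rV[R]_m -> 'M[R]_(m, n)),
    S j (y j) -> chart Rad L a (S j) (y j) c.1.1 c.1.2 c.2.
  move=> j; have [Sj|Sj] := pselect (S j (y j)).
    by have [Q [f [Df C]]] := Sc Sj; exists (Q, f, Df).
  (* Placeholder for the indices with [y j] outside [S j], which form a set negligible for [U]. *)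
  by exists (0, fun=> 0, fun=> 0).
pose Qs j := (c j).1.1; pose fs j := (c j).1.2; pose Ds j := (c j).2.
have C : \forall j \near U, chart Rad L a (S j) (y j) (Qs j) (fs j) (Ds j).
  by apply: filterS Sy => j; exact: Hc.
have [Q QU] : exists Q, mcvg U Qs Q.
  apply: (@ultra_mcvg_opnorm R _ U UF _ _ _ 1).
  by apply: filterS C => j [oQ _ _ _ _] v; rewrite enorm_ortho// mul1r.
have /choice[f fU] : forall xi, exists f, mcvg U (fun j => fs j xi) f.
  move=> xi; apply: (@ultra_mcvg_row R _ U UF _ _ (enorm xi)).
  apply: filterS C => j [_ _ _ _ [f0 _ _ fl]].
  by have := fl xi 0; rewrite f0 !subr0.
have /choice[Df DU] : forall xi, exists D, mcvg U (fun j => Ds j xi) D.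
  move=> xi; apply: (@ultra_mcvg_opnorm R _ U UF _ _ _ (L * enorm xi `^ a)).
  apply: filterS C => j [_ _ _ _ [_ D0 fh _]].
  by have := fh xi 0; rewrite D0 !subr0.
have QTU : mcvg U (fun j => (Qs j)^T) Q^T by exact: mcvgT.
exists Q, f, Df; split.
- apply: (mcvg_unique (F := U) (mcvgM QU QTU) (mcvg_cst _)).
  by apply: filterS C => j [].
- move=> xi; apply: (mcvg_unique (F := U) (mcvgM (fU xi) QTU) (mcvg_cst _)).
  by apply: filterS C => j [_ + _ _ _]; exact.
(* Differentiability is not closed under pointwise limits, but the Taylor bound with the common
   constant [L] is, and it implies differentiability. *)
- apply: (hasDeriv_powR a0) => xi; exists L => eta _.
  apply: (mcvg_le (mcvgB (mcvgB (fU eta) (fU xi))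
    (mcvgM (mcvg_cst (eta - xi)) (DU xi)))).
  apply: filterS C => j [_ _ fD _ [_ _ fh _]].
  exact: holder_taylor.
- apply/seteqP; split=> z [].
    move=> Sz zx; split => //; have [w [Sw wz]] := ulimset_seq UF Uoo Sz.
    have wy : mcvg U (fun j => w j - y j) (z - x) by exact: mcvgB.
    have wyR : \forall j \near U, enorm (w j - y j) < Rad by exact: mcvg_lt wy zx.
    pose xi := (z - x) *m Q^T.
    have xiU : mcvg U (fun j => (w j - y j) *m (Qs j)^T) xi by exact: mcvgM.
    exists xi => //.
    (* The normal part of [w j - y j] is the chart at the moving coordinate (w j - y j) Q_j^T. The
       Lipschitz bound compares it with the chart at the fixed [xi], at a cost that tends to |xi -
       xi| = 0. *)
    have E : enorm (f xi - (z - x - xi *m Q)) <= enorm (xi - xi).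
      apply: (mcvg_le2 (F := U)
        (mcvgB (fU xi) (mcvgB wy (mcvgM xiU QU))) (mcvgB (mcvg_cst xi) xiU)).
      apply: filterS (filterI (filterI C Sw) wyR) => j
        [[[oQ fp _ E [_ _ _ fl]] Sj] wj].
      have : (S j `&` eball (y j) Rad) (w j) by split.
      rewrite E => -[[e _ <-] _].
      rewrite [y j + _ - y j]addrC addKr mulmxDl mulmx_orthoK// fp addr0.
      by rewrite [e *m _ + _ - _]addrC addKr.
    move: E; rewrite subrr enorm0 => E.
    have /enorm_eq0/eqP : enorm (f xi - (z - x - xi *m Q)) = 0.
      by apply/eqP; rewrite eq_le E enorm_ge0.
    rewrite subr_eq0 => /eqP ->.
    by rewrite [xi *m Q + _]addrC subrK addrC subrK.
  (* Conversely, the strict bound by [Rad] persists along [U], so the approximating graph points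
     belong to [S j] and their limit to [ulimset]. *)
  move=> [xi _ <-]; rewrite /eball/= [x + _ - x]addrC addKr => xiR.
  split => //.
  have gU : mcvg U (fun j => xi *m Qs j + fs j xi) (xi *m Q + f xi).
    exact: (mcvgD (mcvgM (mcvg_cst xi) QU) (fU xi)).
  apply: (ulimset_mcvg UF _ (mcvgD yx gU)).
  apply: filterS (filterI C (mcvg_lt gU xiR)) => j [[_ _ _ E _] gj].
  suff [] : (S j `&` eball (y j) Rad) (y j + (xi *m Qs j + fs j xi)) by [].
  by rewrite E; split; [exists xi|rewrite /eball/= [y j + _ - _]addrC addKr].
- split.
  + apply: (mcvg_unique (F := U) (fU 0) (mcvg_cst _)).
    by apply: filterS C => j [_ _ _ _ []].
  + apply: (mcvg_unique (F := U) (DU 0) (mcvg_cst _)).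
    by apply: filterS C => j [_ _ _ _ []].
  + move=> xi eta v; apply: (mcvg_le
      (mcvgM (mcvg_cst v) (mcvgB (DU xi) (DU eta)))).
    by apply: filterS C => j [_ _ _ _ [_ _ + _]]; exact.
  + move=> xi eta; apply: (mcvg_le (mcvgB (fU xi) (fU eta))).
    by apply: filterS C => j [_ _ _ _ [_ _ _]]; exact.
Qed.

End ChartLimit.

(** * Tangent planes of Hausdorff-close sets *)

Section Tilt.
Variables (R : realType) (m n : nat) (Rad L a : R).
Hypotheses (a0 : 0 < a) (L0 : 0 <= L).

Lemma chart_lip0 S x (Q : 'M[R]_(m, n)) f Df xi :
  chart Rad L a S x Q f Df -> enorm (f xi) <= enorm xi.
Proof.
by move=> [_ _ _ _ [f0 _ _ fl]]; have := fl xi 0; rewrite f0 !subr0.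
Qed.

Lemma chart_flat S x (Q : 'M[R]_(m, n)) f Df xi :
  chart Rad L a S x Q f Df -> enorm (f xi) <= L * enorm xi `^ a * enorm xi.
Proof.
move=> [_ _ fD _ [f0 D0 fh _]].
by have := holder_taylor 0 xi a0 L0 fD fh; rewrite f0 D0 !subr0 mulmx0 subr0.
Qed.

Lemma chart_graph S x (Q : 'M[R]_(m, n)) f Df xi : chart Rad L a S x Q f Df ->
  enorm (xi *m Q + f xi) < Rad -> S (x + (xi *m Q + f xi)).
Proof.
move=> [_ _ _ E _] xiR.
suff [] : (S `&` eball x Rad) (x + (xi *m Q + f xi)) by [].
by rewrite E; split; [exists xi|rewrite /eball/= [x + _ - _]addrC addKr].
Qed.

Lemma chart_param S x (Q : 'M[R]_(m, n)) f Df z : chart Rad L a S x Q f Df ->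
  S z -> enorm (z - x) < Rad -> exists xi, z - x = xi *m Q + f xi.
Proof.
move=> [_ _ _ E _] Sz zR.
have : (S `&` eball x Rad) z by split.
by rewrite E => -[[xi _ <-] _]; exists xi; rewrite [x + _ - _]addrC addKr.
Qed.

(* A point of the first graph at distance about r from x lies within a small
   multiple of r of the first tangent plane and, by closeness, of the second. *)
Lemma chart_tilt S S' x x' (Q Q' : 'M[R]_(m, n)) f f' Df Df' (r delta : R) :
  0 < r -> 4 * r < Rad -> delta <= r / 64 ->
  (forall t, 0 <= t <= 4 * r -> L * t `^ a <= 1 / 64) ->
  chart Rad L a S x Q f Df -> chart Rad L a S' x' Q' f' Df' ->
  enorm (x - x') <= delta ->
  (forall z, S z -> exists2 z', S' z' & enorm (z - z') <= delta) ->
  forall v, enorm (v *m Q - v *m Q *m Q'^T *m Q') <= 1 / 4 * enorm v.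
Proof.
move=> r0 rR dr Lr C C' xx' SS' v.
have [oQ _ _ _ _] := C; have [oQ' fp' _ _ _] := C'.
have [->|v0] := eqVneq v 0.
  by rewrite !mul0mx subr0 !enorm0 mulr0.
have {}v0 := enorm_gt0 v0.
pose t := r / enorm v; have t0 : 0 < t by rewrite divr_gt0.
pose xi := t *: v.
have xir : enorm xi = r by rewrite enormZ gtr0_norm// divfK// gt_eqF.
(* [P] is the orthogonal projection onto the complement of the second plane; by homogeneity it is
   enough to treat [xi], which has length [r]. *)
pose P (w : 'rV[R]_n) := w - w *m Q'^T *m Q'.
have PB u w : P (u - w) = P u - P w.
  by rewrite /P !mulmxBl; apply/rowP => i; rewrite !mxE; ring.
have Ple w : enorm (P w) <= enorm w.
  rewrite -(@ler_pXn2r _ 2) ?nnegrE ?enorm_ge0//.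
  by rewrite (enorm_proj oQ' w) lerDr sqr_ge0.
suff H : enorm (P (xi *m Q)) <= 1 / 4 * r.
  rewrite -(ler_pM2l t0).
  have -> : t * (1 / 4 * enorm v) = 1 / 4 * r.
    by rewrite /t; field; rewrite gt_eqF.
  rewrite -[t in t * _]gtr0_norm// -enormZ.
  by move: H; rewrite /P /xi -!scalemxAl -scalerBr.
have fxi : enorm (f xi) <= r / 64.
  apply: le_trans (chart_flat xi C) _; rewrite xir.
  have := Lr r; rewrite (ltW r0)/= => /(_ _)H; have {}H := H ltac:(lra); nra.
have zx : enorm (xi *m Q + f xi) <= 2 * r.
  apply: le_trans (ler_enormD _ _) _; rewrite enorm_ortho// xir.
  have := chart_lip0 xi C; rewrite xir; lra.
have Sz : S (x + (xi *m Q + f xi)) by apply: (chart_graph C); lra.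
set z := x + _ in Sz.
have [z' Sz' zz'] := SS' z Sz.
have zxE : z - x = xi *m Q + f xi by rewrite [z - x]addrC addKr.
have zx' : enorm (z' - x') <= 4 * r.
  have := ler_enorm_dist z z' x'; have := ler_enorm_dist x z x'.
  rewrite zxE (enorm_distC z' z); lra.
have [xi' E'] := chart_param C' Sz' (le_lt_trans zx' rR).
have xi'r : enorm xi' <= 4 * r.
  apply: le_trans zx'; rewrite E'.
  apply: le_trans (ler_enorm_orthoT oQ' _).
  by rewrite mulmxDl mulmx_orthoK// fp' addr0.
have fxi' : enorm (f' xi') <= r / 16.
  apply: le_trans (chart_flat xi' C') _.
  have := Lr (enorm xi'); rewrite enorm_ge0 xi'r/= => /(_ isT) H.
  have := enorm_ge0 xi'; nra.
(* [P] removes the planar part of [z' - x'] and fixes [f' xi']. The three terms are at most r/16, 2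
   delta <= r/32 and r/64, well below r/4 in total. *)
have -> : P (xi *m Q) = f' xi' - P ((z' - x') - (z - x)) - P (f xi).
  have -> : xi *m Q = (z' - x') - ((z' - x') - (z - x)) - f xi.
    by rewrite zxE; apply/rowP => i; rewrite !mxE; ring.
  rewrite [P (_ - f xi)]PB (PB (z' - x')); congr (_ - _ - _).
  by rewrite /P E' mulmxDl mulmx_orthoK// fp' addr0 addrC addKr.
apply: le_trans (ler_enormB _ _) _.
have := ler_enormB (f' xi') (P ((z' - x') - (z - x))).
have := Ple (f xi); have := Ple ((z' - x') - (z - x)).
have : enorm ((z' - x') - (z - x)) <= 2 * delta.
  have -> : (z' - x') - (z - x) = (z' - z) - (x' - x).
    by apply/rowP => i; rewrite !mxE; ring.
  have := ler_enormB (z' - z) (x' - x).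
  rewrite (enorm_distC z' z) (enorm_distC x' x); lra.
lra.
Qed.

End Tilt.

(** * Fixed points of contractions and inverses of matrices bounded below *)

Section Inversion.
Variable R : realType.

(** The Picard iterates from 0 stay in the ball of radius [2 * D] and their successive increments
    tend to 0, so their ultralimit is a fixed point. *)
Lemma contraction_fixed m (T : 'rV[R]_m -> 'rV[R]_m) :
  (forall xi eta, enorm (T xi - T eta) <= 1 / 2 * enorm (xi - eta)) ->
  exists xi, T xi = xi.
Proof.
move=> TL; pose D := enorm (T 0); pose u k := iter k T 0.
have D0 : 0 <= D by exact: enorm_ge0.
have uD k : enorm (u k) <= 2 * D.
  elim: k => [|k IH]; first by rewrite /u/= enorm0; lra.
  have := TL (u k) 0; have := ler_enorm_sub (T (u k)) (T 0).
  rewrite -/D subr0 -[T (u k)]/(u k.+1); lra.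
have uS k : enorm (u k.+1 - u k) <= D * k.+1%:R^-1.
  have : enorm (u k.+1 - u k) <= D * (2 ^ k)%:R^-1.
    elim: k => [|k IH]; first by rewrite /u/= subr0 expn0 invr1 mulr1.
    apply: le_trans (TL _ _) _.
    rewrite expnS natrM invfM mulrCA div1r ler_wpM2l// invr_ge0; lra.
  move=> /le_trans; apply; rewrite ler_wpM2l// lef_pV2 ?posrE ?ltr0n ?expn_gt0//.
  by rewrite ler_nat ltn_expl.
have [U [UF Uoo]] := ultraFilterLemma (_ : ProperFilter (\oo : set_system nat)).
have [|l ul] := @ultra_mcvg_row R _ U UF _ u (2 * D).
  by apply: filterE => k; exact: uD.
exists l; apply/eqP; rewrite -subr_eq0; apply/eqP/enorm_eq0.
apply/eqP; rewrite eq_le enorm_ge0 andbT; apply/ler_addgt0Pr => e e0.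
(* The distance from [T l] to [l] is at most 3/2 |u_k - l| + D / (k + 1), so making both |u_k - l|
   and 1 / (k + 1) smaller than this quantity suffices. *)
have e3 : 0 < e / (3 + D) by rewrite divr_gt0//; lra.
have H : \forall k \near U, k.+1%:R^-1 < e / (3 + D).
  by apply: Uoo; exact: near_infty_natSinv_lt (PosNum e3).
have [k [/= kl ke]] := filter_ex (filterI (mcvg_dist ul e3) H).
have := ler_enorm_dist (u k) (T l) l; have := ler_enorm_dist (u k.+1) (T l) (u k).
have := uS k; have := TL l (u k); rewrite -[T (u k)]/(u k.+1) (enorm_distC l (u k)).
have : D * k.+1%:R^-1 <= D * (e / (3 + D)) by rewrite ler_wpM2l// ltW.
have E : e = 3 * (e / (3 + D)) + D * (e / (3 + D)) by field; rewrite gt_eqF//; lra.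
rewrite add0r; move: E kl e3; move: (e / (3 + D)) => w.
move: (k.+1%:R^-1) => q; move: (D * w) (D * q) => Dw Dq; lra.
Qed.

Lemma lower_unitmx m (A : 'M[R]_m) (c : R) :
  (forall v : 'rV[R]_m, enorm v <= c * enorm (v *m A)) ->
  A \in unitmx /\ opnorm_le (invmx A) c.
Proof.
move=> cA.
have uA : A \in unitmx.
  rewrite -row_free_unit -kermx_eq0; apply/eqP/row_matrixP => i; rewrite row0.
  apply: enorm_eq0; apply/eqP; rewrite eq_le enorm_ge0 andbT.
  by have := cA (row i (kermx A)); rewrite -row_mul mulmx_ker row0 enorm0 mulr0.
by split=> // v; have := cA (v *m invmx A); rewrite mulmxKV.
Qed.

End Inversion.

(** * Rewriting a graph over a nearby plane *)

Section RegraphOverTiltedPlane.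
Variables (R : realType) (m n : nat) (L a : R) (x y : 'rV[R]_n).
Variables (Q Q' : 'M[R]_(m, n)) (f : 'rV[R]_m -> 'rV[R]_n).
Variable Df : 'rV[R]_m -> 'M[R]_(m, n).
Hypotheses (a0 : 0 < a) (a1 : a <= 1) (L0 : 0 <= L).
Hypotheses (oQ : orthonormal Q) (oQ' : orthonormal Q') (fp : into_perp Q' f).
Hypotheses (fD : hasDeriv f Df) (fh : holder Df L a).
Hypothesis fl : forall xi eta, enorm (f xi - f eta) <= enorm (xi - eta).
Hypothesis tilt1 :
  forall v, enorm (v *m Q' - v *m Q' *m Q^T *m Q) <= 1 / 4 * enorm v.
Hypothesis tilt2 :
  forall v, enorm (v *m Q - v *m Q *m Q'^T *m Q') <= 1 / 4 * enorm v.

(* This needs no smallness of the Lipschitz constant of f: values of f are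
   orthogonal to the rows of Q', so Q^T maps them to short vectors. *)
Lemma perp_tilt w : w *m Q'^T = 0 -> enorm (w *m Q^T) <= 1 / 4 * enorm w.
Proof.
move=> w0; set u := w *m Q^T.
have : enorm u ^+ 2 <= enorm w * (1 / 4 * enorm u).
  have -> : enorm u ^+ 2 = (w *m (u *m Q - u *m Q *m Q'^T *m Q')^T) 0 0.
    rewrite enorm_sqr; congr ((_ : 'M[R]_1) 0 0).
    rewrite linearB/= mulmxBr (trmx_mul _ Q') (mulmxA w Q'^T) w0 mul0mx subr0.
    by rewrite (trmx_mul u Q) mulmxA.
  apply: le_trans (cauchy_schwarz _ _) _.
  by rewrite ler_wpM2l ?enorm_ge0.
have := enorm_ge0 u; have := enorm_ge0 w; nra.
Qed.

(** Pythagoras: the part of [v *m Q'] off the plane of [Q] is at most a quarter of |v|, and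
    sqrt(15/16) >= 3/4. *)
Lemma tilt_lower (v : 'rV[R]_m) : 3 / 4 * enorm v <= enorm (v *m (Q' *m Q^T)).
Proof.
have := enorm_proj oQ (v *m Q'); rewrite (enorm_ortho oQ') mulmxA.
have := tilt1 v; have := enorm_ge0 v; have := enorm_ge0 (v *m Q' *m Q^T).
have := enorm_ge0 (v *m Q' - v *m Q' *m Q^T *m Q).
move: (enorm v) (enorm (_ *m Q^T)) (enorm (_ - _)) => A B C ? ? ? ? ?.
rewrite leNgt; apply/negP => ?; nra.
Qed.

Lemma deriv_le1 xi : opnorm_le (Df xi) 1.
Proof.
rewrite -[Df xi]mulmx1; apply: (deriv_opnorm_le fD) => v.
  by rewrite mulmx1 mul1r.
by rewrite mulmx1 mul1r.
Qed.

Lemma deriv_tilt xi : opnorm_le (Df xi *m Q^T) (1 / 4).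
Proof.
apply: (deriv_opnorm_le fD) => v.
  by rewrite mul1r ler_enorm_orthoT.
apply: le_trans (perp_tilt _) _; first by rewrite mulmxBl !fp subrr.
by rewrite ler_wpM2l// divr_ge0.
Qed.

(** [F] parametrises the graph based at [y], relative to the new base point [x]; [M] is its
    derivative and [N] the derivative of its projection to the plane of [Q]. *)
Let M xi := Q' + Df xi.
Let N xi := M xi *m Q^T.
Let F xi := y - x + (xi *m Q' + f xi).

Lemma tangent_le xi : opnorm_le (M xi) 2.
Proof.
move=> v; rewrite mulmxDr; apply: le_trans (ler_enormD _ _) _.
rewrite enorm_ortho//; have := deriv_le1 xi v; lra.
Qed.

(** The plane contributes at least 3/4 and the derivative of [f] at most 1/4 along [Q], so [N xi]
    expands by at least 1/2. *)
Lemma tangent_inv xi : N xi \in unitmx /\ opnorm_le (invmx (N xi)) 2.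
Proof.
apply: lower_unitmx => v; rewrite /N /M mulmxDl mulmxDr.
have := tilt_lower v; have := deriv_tilt xi v.
have := ler_enorm_sub (v *m (Q' *m Q^T)) (- (v *m (Df xi *m Q^T))).
by rewrite opprK enormN; lra.
Qed.

Lemma graph_diff xi eta :
  F xi - F eta = (xi - eta) *m Q' + (f xi - f eta).
Proof. by rewrite /F mulmxBl; apply/rowP => i; rewrite !mxE; ring. Qed.

Lemma graph_diff_le xi eta : enorm (F xi - F eta) <= 2 * enorm (xi - eta).
Proof.
rewrite graph_diff; apply: le_trans (ler_enormD _ _) _.
rewrite enorm_ortho//; have := fl xi eta; lra.
Qed.

(** The same balance 3/4 - 1/4 = 1/2 for finite increments: projection of the graph to the plane of
    [Q] is injective with a 2-Lipschitz inverse. *)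
Lemma proj_lower xi eta :
  enorm (xi - eta) <= 2 * enorm (F xi *m Q^T - F eta *m Q^T).
Proof.
rewrite -mulmxBl graph_diff (mulmxDl _ _ Q^T) -mulmxA.
have := tilt_lower (xi - eta); have := fl xi eta.
have := @perp_tilt (f xi - f eta).
rewrite (mulmxBl _ _ Q'^T) !fp subrr => /(_ erefl).
have := ler_enorm_sub ((xi - eta) *m (Q' *m Q^T)) (- ((f xi - f eta) *m Q^T)).
by rewrite opprK enormN; lra.
Qed.

(** Solving for the planar term turns the equation into a fixed point problem with contraction
    factor 4/3 * 1/4 = 1/3. Since [f] is defined on the whole plane, every [eta] is reached. *)
Lemma proj_surj eta : exists xi, F xi *m Q^T = eta.
Proof.
have [|uA iA] := @lower_unitmx R m (Q' *m Q^T) (4 / 3).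
  by move=> v; have := tilt_lower v; lra.
have [|xi xiE] := @contraction_fixed R m
  (fun xi => (eta - (y - x) *m Q^T - f xi *m Q^T) *m invmx (Q' *m Q^T)).
  move=> xi zeta; rewrite -mulmxBl.
  have -> (A B C : 'rV[R]_m) : A - B - (A - C) = C - B.
    by apply/rowP => i; rewrite !mxE; ring.
  rewrite -mulmxBl; apply: le_trans (iA _) _.
  have := @perp_tilt (f zeta - f xi).
  rewrite (mulmxBl _ _ Q'^T) !fp subrr => /(_ erefl).
  rewrite (enorm_distC xi); have := fl zeta xi.
  have := enorm_ge0 (zeta - xi); lra.
exists xi; have : xi *m (Q' *m Q^T) = eta - (y - x) *m Q^T - f xi *m Q^T.
  by rewrite -[in LHS]xiE mulmxKV.
rewrite /F !mulmxDl -mulmxA => ->.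
by rewrite subrK addrC subrK.
Qed.

(** With [psi] the inverse of the projected parametrisation, the new graph function is the part of
    [F (psi eta)] off the plane of [Q], and its derivative is N^-1 M - Q. Both constants 5 are 2 * 2
    + 1. *)
Lemma regraph : exists g Dg,
  [/\ into_perp Q g, hasDeriv g Dg, graph_at y Q' f = graph_at x Q g &
      [/\ forall eta zeta, enorm (g eta - g zeta) <= 5 * enorm (eta - zeta),
          forall eta, opnorm_le (Dg eta) 5 & holder Dg (20 * L) a]].
Proof.
have /choice[psi psiE] := proj_surj.
have psiL eta zeta : enorm (psi eta - psi zeta) <= 2 * enorm (eta - zeta).
  by apply: le_trans (proj_lower _ _) _; rewrite !psiE.
(* The factor 2^a is at most 2 because a <= 1. *)
have psiP eta zeta :
    enorm (psi eta - psi zeta) `^ a <= 2 * enorm (eta - zeta) `^ a.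
  apply: (@le_trans _ _ ((2 * enorm (eta - zeta)) `^ a)).
    by rewrite ge0_ler_powR ?nnegrE ?mulr_ge0 ?enorm_ge0// ltW.
  rewrite powRM ?enorm_ge0// ler_wpM2r ?powR_ge0//.
  rewrite -[leRHS](@powRr1 _ 2)// ler_powR//; lra.
have psiK xi : psi (F xi *m Q^T) = xi.
  apply/eqP; rewrite -subr_eq0; apply/eqP/enorm_eq0/eqP.
  rewrite eq_le enorm_ge0 andbT; apply: le_trans (proj_lower _ _) _.
  by rewrite psiE subrr enorm0 mulr0.
exists (fun eta => F (psi eta) - eta *m Q).
exists (fun eta => invmx (N (psi eta)) *m M (psi eta) - Q); split.
- by move=> eta; rewrite mulmxBl psiE mulmx_orthoK// subrr.
- apply: (hasDeriv_powR a0) => eta; exists (20 * L) => zeta _.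
  set xi := psi eta; set xi' := psi zeta.
  pose E := f xi' - f xi - (xi' - xi) *m Df xi.
  have [uN iN] := tangent_inv xi.
  have FE : F xi' - F xi = (xi' - xi) *m M xi + E.
    rewrite graph_diff /E mulmxDr; apply/rowP => i; rewrite !mxE; ring.
  have eE : zeta - eta = (xi' - xi) *m N xi + E *m Q^T.
    by rewrite /N mulmxA -mulmxDl -FE mulmxBl !psiE.
  (* The linear terms cancel and leave only the Taylor error [E] of [f], transformed by a map of
     norm at most 1 + 2 * 2 = 5. The 2-Lipschitz change of variable [psi] supplies the remaining
     factor 4 in [20 * L]. *)
  have -> : F xi' - zeta *m Q - (F xi - eta *m Q) -
      (zeta - eta) *m (invmx (N xi) *m M xi - Q) =
      E - E *m Q^T *m invmx (N xi) *m M xi.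
    rewrite mulmxBr.
    have -> : (zeta - eta) *m (invmx (N xi) *m M xi) =
        (xi' - xi) *m M xi + E *m Q^T *m invmx (N xi) *m M xi.
      by rewrite eE mulmxA mulmxDl mulmxK// mulmxDl.
    rewrite (mulmxBl zeta eta Q).
    have -> : F xi' = F xi + ((xi' - xi) *m M xi + E).
      by rewrite -FE addrC subrK.
    have id6 (A B C V E1 W : 'rV[R]_n) :
        A + (V + E1) - B - (A - C) - (V + W - (B - C)) = E1 - W.
      by apply/rowP => i; rewrite !mxE; ring.
    exact: id6.
  have El : enorm E <= L * enorm (xi' - xi) `^ a * enorm (xi' - xi).
    exact: holder_taylor.
  apply: (@le_trans _ _ (5 * enorm E)).
    apply: le_trans (ler_enormB _ _) _.
    have := tangent_le xi (E *m Q^T *m invmx (N xi)).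
    have := iN (E *m Q^T); have := ler_enorm_orthoT oQ E; lra.
  have -> (p t : R) : 20 * L * p * t = 5 * (L * (2 * p * (2 * t))) by ring.
  apply: ler_wpM2l; first by rewrite ler0n.
  apply: le_trans El _; rewrite -(mulrA L); apply: (ler_wpM2l L0).
  exact: (ler_pM (powR_ge0 _ _) (enorm_ge0 _) (psiP _ _) (psiL _ _)).
- apply/seteqP; split=> z [xi _ <-].
    exists (F xi *m Q^T) => //; rewrite psiK [_ *m Q + _]addrC subrK.
    by rewrite /F addrA [x + _]addrC subrK.
  exists (psi xi) => //; rewrite [_ *m Q + _]addrC subrK.
  by rewrite /F [RHS]addrA [x + _]addrC subrK.
- split.
  + move=> eta zeta.
    have -> : F (psi eta) - eta *m Q - (F (psi zeta) - zeta *m Q) =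
        F (psi eta) - F (psi zeta) - (eta - zeta) *m Q.
      by rewrite mulmxBl; apply/rowP => i; rewrite !mxE; ring.
    apply: le_trans (ler_enormB _ _) _; rewrite (enorm_ortho oQ).
    have := graph_diff_le (psi eta) (psi zeta); have := psiL eta zeta; lra.
  + move=> eta v; rewrite mulmxBr mulmxA.
    apply: le_trans (ler_enormB _ _) _; rewrite (enorm_ortho oQ).
    have [_ iN] := tangent_inv (psi eta).
    have := tangent_le (psi eta) (v *m invmx (N (psi eta))); have := iN v; lra.
  + move=> eta zeta v; set xi := psi eta; set xi' := psi zeta.
    have [uN iN] := tangent_inv xi; have [uN' iN'] := tangent_inv xi'.
    pose th := L * enorm (xi - xi') `^ a.
    have th0 : 0 <= th by rewrite mulr_ge0 ?powR_ge0.
    pose w := v *m invmx (N xi).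
    have -> : v *m (invmx (N xi) *m M xi - Q - (invmx (N xi') *m M xi' - Q)) =
        w *m (Df xi - Df xi') -
        w *m (Df xi - Df xi') *m Q^T *m invmx (N xi') *m M xi'.
      have -> : v *m (invmx (N xi) *m M xi - Q - (invmx (N xi') *m M xi' - Q)) =
          w *m M xi - v *m invmx (N xi') *m M xi'.
        by rewrite !mulmxBr -!mulmxA /w; apply/rowP => i; rewrite !mxE; ring.
      (* Resolvent identity: the difference of inverses becomes a difference of [Df]. The final
         bound is 5 * 2 * th, and [psiP] contributes the last factor 2. *)
      have -> : v *m invmx (N xi') = w + w *m (N xi - N xi') *m invmx (N xi').
        by rewrite mulmxBr mulmxBl mulmxK// /w mulmxKV// addrC subrK.
      have -> : N xi - N xi' = (Df xi - Df xi') *m Q^T.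
        by rewrite /N -mulmxBl /M opprD addrACA subrr add0r.
      have -> : M xi = M xi' + (Df xi - Df xi').
        by rewrite /M -addrA [Df xi' + _]addrC subrK.
      by rewrite mulmxDl mulmxDr !mulmxA; apply/rowP => i; rewrite !mxE; ring.
    apply: (@le_trans _ _ (10 * th * enorm v)).
      have wl : enorm w <= 2 * enorm v by exact: iN.
      have := fh xi xi' w; rewrite -/th.
      set w1 := w *m (Df xi - Df xi') => w1l.
      have w1v : enorm w1 <= th * (2 * enorm v).
        by apply: le_trans w1l _; rewrite ler_wpM2l.
      apply: le_trans (ler_enormB _ _) _.
      have := tangent_le xi' (w1 *m Q^T *m invmx (N xi')).
      have := iN' (w1 *m Q^T); have := ler_enorm_orthoT oQ w1; lra.
    apply: ler_wpM2r; first exact: enorm_ge0.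
    have := ler_wpM2l L0 (psiP eta zeta); rewrite -/xi -/xi' -/th; lra.
Qed.

End RegraphOverTiltedPlane.

(** * An explicit cutoff of class C^{1,1} *)

Section Bump.
Variable R : realType.

(* The cubic 1 - 3 w^2 + 2 w^3 is critical at w = 0 and w = 1, so composing it
   with the clamp of s - 1 to [0, 1] is C^{1,1}. *)
Definition clamp (s : R) : R := Num.min 1 (Num.max 0 (s - 1)).
Definition bump (s : R) : R := 1 - 3 * clamp s ^+ 2 + 2 * clamp s ^+ 3.
Definition dbump (s : R) : R := - 6 * clamp s * (1 - clamp s).

Variant clamp_spec (s : R) : R -> Type :=
| ClampLow of s <= 1 : clamp_spec s 0
| ClampMid of 1 <= s & s <= 2 : clamp_spec s (s - 1)
| ClampHigh of 2 <= s : clamp_spec s 1.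

Lemma clampP s : clamp_spec s (clamp s).
Proof.
rewrite /clamp; case: (leP 0 (s - 1)) => h1.
  case: (leP 1 (s - 1)) => h2; first by constructor; lra.
  by constructor; lra.
by rewrite min_r ?ler01//; constructor; lra.
Qed.

Lemma clamp_itv s : 0 <= clamp s <= 1.
Proof. by case: (clampP s) => [?|? ?|?]; apply/andP; split; lra. Qed.

Lemma clamp_lip s t : `|clamp s - clamp t| <= `|s - t|.
Proof.
have [st|st] := leP s t.
  rewrite (ler0_norm (_ : s - t <= 0)); last lra.
  by case: (clampP s) => [?|? ?|?]; case: (clampP t) => [?|? ?|?];
    rewrite ler_norml; apply/andP; split; lra.
rewrite (gtr0_norm (_ : 0 < s - t)); last lra.
by case: (clampP s) => [?|? ?|?]; case: (clampP t) => [?|? ?|?];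
  rewrite ler_norml; apply/andP; split; lra.
Qed.

(** The product is nonzero only when [t] is in the transition zone and [s] outside it. Then
    [dbump t] vanishes linearly at the endpoint between them, and 2 p q <= (p + q)^2 for the two
    distances to that endpoint. *)
Lemma clamp_overshoot s t :
  `|dbump t * (clamp s - clamp t - (s - t))| <= 3 * (s - t) ^+ 2.
Proof.
rewrite /dbump; case: (clampP t) => [?|? ?|?].
- by rewrite mulr0 !mul0r normr0 mulr_ge0// sqr_ge0.
- case: (clampP s) => [?|? ?|?].
  + have := mulr_ge0 (_ : 0 <= t - 1) (_ : 0 <= 1 - s).
    rewrite ler_norml => /(_ _ _) H; have {}H := H ltac:(lra) ltac:(lra).
    have [h1 h2] : 0 <= t - 1 /\ 0 <= 1 - (t - 1) by lra.
    by apply/andP; split; nra.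
  + have -> : s - 1 - (t - 1) - (s - t) = 0 by ring.
    by rewrite mulr0 normr0 mulr_ge0// sqr_ge0.
  + have := mulr_ge0 (_ : 0 <= 2 - t) (_ : 0 <= s - 2).
    rewrite ler_norml => /(_ _ _) H; have {}H := H ltac:(lra) ltac:(lra).
    have [h1 h2] : 0 <= t - 1 /\ 0 <= 1 - (t - 1) by lra.
    by apply/andP; split; nra.
- by rewrite subrr mulr0 mul0r normr0 mulr_ge0// sqr_ge0.
Qed.

Lemma ler_norm_factor (x y c z : R) : `|y| <= c -> `|x| <= z -> `|x * y| <= c * z.
Proof. by move=> yc xz; rewrite normrM mulrC ler_pM. Qed.

(** The exact Taylor remainder of the cubic in the clamped variable and the error of linearising the
    clamp each contribute 3. *)
Lemma bump_taylor s t :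
  `|bump s - bump t - dbump t * (s - t)| <= 6 * (s - t) ^+ 2.
Proof.
set w := clamp s; set z := clamp t.
have -> : bump s - bump t - dbump t * (s - t) =
    (w - z) ^+ 2 * (- 3 + 2 * w + 4 * z) + dbump t * (w - z - (s - t)).
  by rewrite /bump /dbump -/w -/z; ring.
apply: le_trans (ler_normD _ _) _.
have -> : 6 * (s - t) ^+ 2 = 3 * (s - t) ^+ 2 + 3 * (s - t) ^+ 2 by ring.
apply: lerD (clamp_overshoot _ _); apply: ler_norm_factor.
  have /andP[? ?] := clamp_itv s; have /andP[? ?] := clamp_itv t.
  by rewrite ler_norml; apply/andP; split; rewrite /w /z; lra.
by rewrite normrX -[leRHS]real_normK ?num_real// ler_pXn2r ?nnegrE// clamp_lip.
Qed.

Lemma bump_lip s t : `|bump s - bump t| <= 6 * `|s - t|.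
Proof.
set w := clamp s; set z := clamp t.
have -> : bump s - bump t =
    (w - z) * (- 3 * (w + z) + 2 * (w ^+ 2 + w * z + z ^+ 2)).
  by rewrite /bump -/w -/z; ring.
apply: ler_norm_factor; last exact: clamp_lip.
have := clamp_itv s; have := clamp_itv t; rewrite -/w -/z.
by move=> /andP[? ?] /andP[? ?]; rewrite ler_norml; apply/andP; split; nra.
Qed.

Lemma dbump_lip s t : `|dbump s - dbump t| <= 6 * `|s - t|.
Proof.
set w := clamp s; set z := clamp t.
have -> : dbump s - dbump t = (w - z) * (- 6 * (1 - w - z)).
  by rewrite /dbump -/w -/z; ring.
apply: ler_norm_factor; last exact: clamp_lip.
have := clamp_itv s; have := clamp_itv t; rewrite -/w -/z.
by move=> /andP[? ?] /andP[? ?]; rewrite ler_norml; apply/andP; split; lra.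
Qed.

Lemma dbump_le s : `|dbump s| <= 6.
Proof.
rewrite /dbump; have := clamp_itv s => /andP[? ?].
by rewrite ler_norml; apply/andP; split; nra.
Qed.

Lemma bump_le s : `|bump s| <= 1.
Proof.
rewrite /bump; have := clamp_itv s; move: (clamp s) => w /andP[w0 w1].
have -> : 1 - 3 * w ^+ 2 + 2 * w ^+ 3 = (1 - w) ^+ 2 * (1 + 2 * w) by ring.
rewrite ger0_norm; last by rewrite mulr_ge0 ?sqr_ge0//; lra.
have -> : (1 - w) ^+ 2 * (1 + 2 * w) = 1 - w ^+ 2 * (3 - 2 * w) by ring.
by rewrite lerBlDr lerDl mulr_ge0 ?sqr_ge0//; lra.
Qed.

Lemma bump1 s : s <= 1 -> bump s = 1.
Proof.
rewrite /bump /clamp => s1.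
by rewrite max_l ?min_r ?ler01// ?expr0n/= ?mulr0 ?addr0 ?subr0//; lra.
Qed.

Lemma bump0 s : 2 <= s -> bump s = 0 /\ dbump s = 0.
Proof.
rewrite /bump /dbump /clamp => s2.
rewrite max_r ?min_l//; [split; ring|lra|lra].
Qed.

End Bump.

(** [G] is the gradient of [chi], encoded by a quadratic Taylor bound. A single constant [K] serves
    every estimate, and the increments are controlled at distance at most 1. *)
Record cutoff (R : realType) m (rho K : R) (chi : 'rV[R]_m -> R)
    (G : 'rV[R]_m -> 'rV[R]_m) : Prop := Cutoff {
  cutoff_const_ge0 : 0 <= K ;
  cutoff_one : forall xi, enorm xi <= rho -> chi xi = 1 ;
  cutoff_zero : forall xi, 2 * rho <= enorm xi -> chi xi = 0 /\ G xi = 0 ;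
  cutoff_le : forall xi, `|chi xi| <= 1 ;
  cutoff_grad_le : forall xi, enorm (G xi) <= K ;
  cutoff_lip : forall xi eta, enorm (xi - eta) <= 1 ->
    `|chi xi - chi eta| <= K * enorm (xi - eta) ;
  cutoff_grad_lip : forall xi eta, enorm (xi - eta) <= 1 ->
    enorm (G xi - G eta) <= K * enorm (xi - eta) ;
  cutoff_taylor : forall xi eta, enorm (eta - xi) <= 1 ->
    `|chi eta - chi xi - ((eta - xi) *m (G xi)^T) 0 0| <=
      K * enorm (eta - xi) ^+ 2 }.

(** The cutoff is [bump] of |xi|^2 / rho^2: the squared norm has an exact second-order expansion
    even at the origin, and |xi| >= 2 rho makes the argument at least 4, beyond the zero threshold
    2. *)
Lemma cutoff_exists (R : realType) m (rho : R) : 0 < rho ->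
  exists K (chi : 'rV[R]_m -> R) G, cutoff rho K chi G.
Proof.
move=> rho0; pose H := 2 * rho + 1; pose B := (2 * H + 1) / rho ^+ 2.
have r20 : 0 < rho ^+ 2 by rewrite exprn_gt0.
have H0 : 0 <= H by rewrite /H; lra.
have B0 : 0 <= B by rewrite divr_ge0 ?(ltW r20)//; lra.
pose c := 2 / rho ^+ 2; have c0 : 0 <= c by rewrite divr_ge0 ?(ltW r20).
pose sq (xi : 'rV[R]_m) : R := enorm xi ^+ 2 / rho ^+ 2.
pose chi xi := bump (sq xi).
pose G xi : 'rV[R]_m := (c * dbump (sq xi)) *: xi.
(* In order: the constants for the increments of [chi], the increments of [G], the Taylor remainder
   and the size of [G]. Their sum serves as the common constant. *)
pose K1 := 6 * B; pose K2 := c * (6 + 6 * B * H).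
pose K3 := 6 * B ^+ 2 + 3 * c; pose K4 := c * 6 * (2 * rho).
have K10 : 0 <= K1 by rewrite /K1; lra.
have K20 : 0 <= K2 by rewrite /K2; have := mulr_ge0 B0 H0; nra.
have K30 : 0 <= K3 by rewrite /K3; have := sqr_ge0 B; lra.
have K40 : 0 <= K4 by rewrite /K4; nra.
have zero (xi : 'rV[R]_m) : 2 * rho <= enorm xi -> chi xi = 0 /\ G xi = 0.
  move=> h; have [] := @bump0 R (sq xi).
    rewrite ler_pdivlMr//.
    have : (2 * rho) ^+ 2 <= enorm xi ^+ 2.
      by rewrite ler_pXn2r ?nnegrE ?enorm_ge0 ?mulr_ge0// ltW.
    by rewrite exprMn; nra.
  by rewrite /chi /G => -> ->; rewrite mulr0 scale0r.
have sqE xi eta : sq eta - sq xi =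
    c * ((eta - xi) *m xi^T) 0 0 + enorm (eta - xi) ^+ 2 / rho ^+ 2.
  have := enorm_sqrD (eta - xi) xi; rewrite subrK /sq => ->.
  by rewrite /c; field; rewrite gt_eqF.
have sqL (xi eta : 'rV[R]_m) : enorm xi <= H -> enorm (eta - xi) <= 1 ->
    `|sq eta - sq xi| <= B * enorm (eta - xi).
  move=> xiH v1; rewrite sqE; apply: le_trans (ler_normD _ _) _.
  have q0 : 0 <= enorm (eta - xi) ^+ 2 / rho ^+ 2.
    by rewrite divr_ge0 ?sqr_ge0// ltW.
  have := ler_norm_dot (eta - xi) xi.
  rewrite normrM (ger0_norm c0) (ger0_norm q0) {q0}.
  move: (`|_|) => D; have := enorm_ge0 (eta - xi); have := enorm_ge0 xi.
  move: (enorm (eta - xi)) (enorm xi) v1 xiH => v X v1 XH X0 v0 DvX.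
  have -> : c * D + v ^+ 2 / rho ^+ 2 = (2 * D + v ^+ 2) / rho ^+ 2.
    by rewrite /c; field; rewrite gt_eqF.
  have -> : B * v = ((2 * H + 1) * v) / rho ^+ 2.
    by rewrite /B; field; rewrite gt_eqF.
  rewrite ler_pM2r ?invr_gt0//; nra.
have inH (xi eta : 'rV[R]_m) : enorm (eta - xi) <= 1 -> enorm xi <= 2 * rho ->
    enorm xi <= H /\ enorm eta <= H.
  move=> v1 h; split; first by rewrite /H; lra.
  have := ler_enorm_sub eta xi; rewrite /H; lra.
(* Two points at distance at most 1 either both lie where [chi] and [G] vanish, or both lie in the
   ball of radius [H], where [sqL] applies. *)
have near2 (xi eta : 'rV[R]_m) : enorm (eta - xi) <= 1 ->
    (2 * rho <= enorm xi /\ 2 * rho <= enorm eta) \/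
    (enorm xi <= H /\ enorm eta <= H).
  move=> v1; have [h1|h1] := leP (2 * rho) (enorm xi); last first.
    by right; exact: inH (ltW h1).
  have [h2|h2] := leP (2 * rho) (enorm eta); first by left.
  by right; have [] := inH eta xi; rewrite 1?enorm_distC ?(ltW h2).
have K0 : 0 <= K1 + K2 + K3 + K4 by lra.
exists (K1 + K2 + K3 + K4), chi, G; split=> //.
- move=> xi h; apply: bump1; rewrite ler_pdivrMr// mul1r.
  by rewrite ler_pXn2r ?nnegrE ?enorm_ge0// ltW.
- by move=> xi; exact: bump_le.
- move=> xi; have [/zero[_ ->]|h] := leP (2 * rho) (enorm xi).
    by rewrite enorm0.
  apply: (@le_trans _ _ K4); last by lra.
  rewrite enormZ normrM (ger0_norm c0) /K4; apply: ler_pM.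
  - by rewrite mulr_ge0.
  - exact: enorm_ge0.
  - by apply: ler_wpM2l => //; exact: dbump_le.
  - exact: ltW.
- move=> xi eta v1; apply: (@le_trans _ _ (K1 * enorm (xi - eta))); last first.
    by rewrite ler_wpM2r ?enorm_ge0//; lra.
  have [[/zero[-> _] /zero[-> _]]|[h _]] := near2 eta xi v1.
    by rewrite subrr normr0 mulr_ge0 ?enorm_ge0.
  apply: le_trans (bump_lip _ _) _; rewrite -mulrA ler_wpM2l//.
  by rewrite sqL.
- move=> xi eta v1; apply: (@le_trans _ _ (K2 * enorm (xi - eta))); last first.
    by rewrite ler_wpM2r ?enorm_ge0//; lra.
  have [[/zero[_ ->] /zero[_ ->]]|[etaH _]] := near2 eta xi v1.
    by rewrite subrr enorm0 mulr_ge0 ?enorm_ge0.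
  have -> : G xi - G eta = (c * dbump (sq xi)) *: (xi - eta) +
      (c * (dbump (sq xi) - dbump (sq eta))) *: eta.
    by rewrite /G; apply/rowP => i; rewrite !mxE; ring.
  apply: le_trans (ler_enormD _ _) _; rewrite !enormZ !(normrM c) (ger0_norm c0).
  have d1 := dbump_le (sq xi).
  have d2 := le_trans (dbump_lip (sq xi) (sq eta))
    (ler_wpM2l (ler0n _ 6) (sqL _ _ etaH v1)).
  have e1 : `|dbump (sq xi)| * enorm (xi - eta) <= 6 * enorm (xi - eta).
    by rewrite ler_wpM2r ?enorm_ge0.
  have e2 : `|dbump (sq xi) - dbump (sq eta)| * enorm eta <=
      6 * (B * enorm (xi - eta)) * H by rewrite ler_pM ?enorm_ge0.
  have -> : K2 * enorm (xi - eta) = c * (6 * enorm (xi - eta)) +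
      c * (6 * (B * enorm (xi - eta)) * H) by rewrite /K2; ring.
  by rewrite -!(mulrA c); apply: lerD; exact: ler_wpM2l.
- move=> xi eta v1; apply: (@le_trans _ _ (K3 * enorm (eta - xi) ^+ 2)); last first.
    by rewrite ler_wpM2r ?sqr_ge0//; lra.
  have [[/zero[-> ->] /zero[-> _]]|[xiH _]] := near2 xi eta v1.
    by rewrite subrr trmx0 mulmx0 mxE subr0 normr0 mulr_ge0 ?sqr_ge0.
  have -> : chi eta - chi xi - ((eta - xi) *m (G xi)^T) 0 0 =
      chi eta - chi xi - dbump (sq xi) * (sq eta - sq xi) +
      dbump (sq xi) * (enorm (eta - xi) ^+ 2 / rho ^+ 2).
    have -> : ((eta - xi) *m (G xi)^T) 0 0 =
        c * dbump (sq xi) * ((eta - xi) *m xi^T) 0 0.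
      by rewrite /G linearZ/= -scalemxAr mxE.
    by rewrite sqE; ring.
  apply: le_trans (ler_normD _ _) _.
  have t1 := bump_taylor (sq eta) (sq xi).
  have t2 : (sq eta - sq xi) ^+ 2 <= (B * enorm (eta - xi)) ^+ 2.
    rewrite -[leLHS]real_normK ?num_real// ler_pXn2r ?nnegrE//.
      exact: sqL.
    by rewrite mulr_ge0 ?enorm_ge0.
  have -> : K3 * enorm (eta - xi) ^+ 2 = 6 * (B * enorm (eta - xi)) ^+ 2 +
      6 * (enorm (eta - xi) ^+ 2 / rho ^+ 2).
    by rewrite /K3 /c; field; rewrite gt_eqF.
  apply: lerD; first by apply: le_trans t1 _; rewrite ler_wpM2l.
  have q0 : 0 <= enorm (eta - xi) ^+ 2 / rho ^+ 2.
    by rewrite divr_ge0 ?sqr_ge0// ltW.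
  by rewrite normrM (ger0_norm q0) ler_wpM2r ?dbump_le.
Qed.

(** * Product rule with a cutoff, with uniform constants *)

Section CutoffProduct.
Variables (R : realType) (m n : nat) (a rho K : R).
Variables (chi : 'rV[R]_m -> R) (G : 'rV[R]_m -> 'rV[R]_m).
Hypotheses (a0 : 0 < a) (a1 : a <= 1) (cut : cutoff rho K chi G).
Implicit Types (u : 'rV[R]_m -> 'rV[R]_n) (Du : 'rV[R]_m -> 'M[R]_(m, n)).

Definition cutf u xi := chi xi *: u xi.
(* Acting on row vectors, this is v |-> chi *: v Du + <v, G> u. *)
Definition cutD u Du xi := chi xi *: Du xi + (G xi)^T *m u xi.

Lemma mul_rank1 (v g : 'rV[R]_m) (w : 'rV[R]_n) :
  v *m (g^T *m w) = (v *m g^T) 0 0 *: w.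
Proof. by rewrite mulmxA {1}[v *m g^T]mx11_scalar mul_scalar_mx. Qed.

Lemma enorm_rank1 (v g : 'rV[R]_m) (w : 'rV[R]_n) :
  enorm (v *m (g^T *m w)) <= enorm g * enorm w * enorm v.
Proof.
rewrite mul_rank1 enormZ -mulrA (mulrC (enorm w)) mulrA (mulrC (enorm g)).
by rewrite ler_wpM2r ?enorm_ge0// ler_norm_dot.
Qed.

Lemma le_powR1 (t : R) : 0 <= t <= 1 -> t <= t `^ a.
Proof.
move=> /andP[]; rewrite le_eqVlt => /predU1P[<- _|t0 t1].
  by rewrite powR0 ?gt_eqF.
by rewrite -[leLHS]powRr1 ?(ltW t0)// ger_powR// t0.
Qed.

Section Fixed.
Variables (u : 'rV[R]_m -> 'rV[R]_n) (Du : 'rV[R]_m -> 'M[R]_(m, n)).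
Variables (B B0 K0 : R).
Hypotheses (u0 : enorm (u 0) <= B0) (B_ge0 : 0 <= B) (K0_ge0 : 0 <= K0).
Hypothesis ul : forall xi eta, enorm (u xi - u eta) <= B * enorm (xi - eta).
Hypothesis Dl : forall xi, opnorm_le (Du xi) B.
Hypotheses (uD : hasDeriv u Du) (Dh : holder Du K0 a).

Lemma cut_hasDeriv : hasDeriv (cutf u) (cutD u Du).
Proof.
have K_ge0 := cutoff_const_ge0 cut.
apply: (hasDeriv_powR a0) => xi; exists (K0 + K * enorm (u xi) + K * B).
move=> eta v1; set v := eta - xi.
(* The remainder of the product is that of [u], that of [chi], and the product of both increments.
   The last two are quadratic, hence of order 1 + a at distance at most 1. *)
have -> : cutf u eta - cutf u xi - v *m cutD u Du xi =
   chi xi *: (u eta - u xi - v *m Du xi) +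
   (chi eta - chi xi - (v *m (G xi)^T) 0 0) *: u xi +
   (chi eta - chi xi) *: (u eta - u xi).
  rewrite /cutf /cutD mulmxDr mul_rank1 -scalemxAr.
  move: (v *m Du xi) ((v *m _) 0 0) => A c.
  by apply/rowP => i; rewrite !mxE; ring.
have t1 : enorm (u eta - u xi - v *m Du xi) <= K0 * enorm v `^ a * enorm v.
  exact: holder_taylor.
have t2 := cutoff_taylor cut v1.
have t3 := cutoff_lip cut v1.
have vv : enorm v ^+ 2 <= enorm v `^ a * enorm v.
  by rewrite expr2 ler_wpM2r ?enorm_ge0// le_powR1// enorm_ge0.
apply: le_trans (ler_enormD _ _) _.
have -> (p t : R) : (K0 + K * enorm (u xi) + K * B) * p * t =
    K0 * p * t + K * (p * t) * enorm (u xi) + K * B * (p * t) by ring.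
apply: lerD.
  apply: le_trans (ler_enormD _ _) _; rewrite !enormZ; apply: lerD.
    by apply: le_trans t1; rewrite ler_piMl ?enorm_ge0//; exact: cutoff_le cut _.
  rewrite ler_wpM2r ?enorm_ge0//; apply: le_trans t2 _.
  by rewrite ler_wpM2l.
rewrite enormZ.
apply: (@le_trans _ _ (K * enorm v * (B * enorm v))).
  by rewrite ler_pM ?enorm_ge0.
have -> : K * enorm v * (B * enorm v) = K * B * enorm v ^+ 2 by ring.
by rewrite ler_wpM2l// mulr_ge0.
Qed.

Lemma enorm_affine_le xi : enorm (u xi) <= B0 + B * enorm xi.
Proof.
have := ul xi 0; have := ler_enorm_sub (u xi) (u 0); rewrite subr0.
have := u0; lra.
Qed.

Lemma cutD_le xi : 0 <= rho ->
  opnorm_le (cutD u Du xi) (B + K * (B0 + B * (2 * rho))).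
Proof.
move=> rho0 v; have K_ge0 := cutoff_const_ge0 cut.
have B00 : 0 <= B0 by apply: le_trans u0; exact: enorm_ge0.
have B20 : 0 <= B0 + B * (2 * rho) by rewrite addr_ge0// mulr_ge0//; lra.
have [/(cutoff_zero cut)[c0 g0]|h] := leP (2 * rho) (enorm xi).
  rewrite /cutD c0 g0 scale0r trmx0 mul0mx addr0 mulmx0 enorm0.
  by rewrite mulr_ge0 ?enorm_ge0// addr_ge0// mulr_ge0.
rewrite /cutD mulmxDr; apply: le_trans (ler_enormD _ _) _.
rewrite mulrDl; apply: lerD.
  rewrite -scalemxAr enormZ; apply: (le_trans _ (Dl xi v)).
  by rewrite ler_piMl ?enorm_ge0//; exact: cutoff_le cut _.
apply: le_trans (enorm_rank1 _ _ _) _; rewrite ler_wpM2r ?enorm_ge0//.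
apply: ler_pM; rewrite ?enorm_ge0//; first exact: cutoff_grad_le cut _.
by apply: le_trans (enorm_affine_le xi) _; rewrite lerD2l ler_wpM2l// ltW.
Qed.

(** The terms collect the four pieces of the increment of [cutD]; the last factor bounds |u| on the
    ball of radius 2 rho + 1. Only bounds on [u] enter, so the constant is uniform over families. *)
Definition cut_const := 2 * (K * B) + K0 + K * (B0 + B * (2 * rho + 1)).

Lemma cutD_holder1 xi eta : 0 <= rho -> enorm (xi - eta) <= 1 ->
  opnorm_le (cutD u Du xi - cutD u Du eta) (cut_const * enorm (xi - eta) `^ a).
Proof.
move=> rho0 d1 v; have K_ge0 := cutoff_const_ge0 cut.
have B00 : 0 <= B0 by apply: le_trans u0; exact: enorm_ge0.
have C0 : 0 <= cut_const.
  have r1 : 0 <= 2 * rho + 1 by lra.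
  have b1 : 0 <= B0 + B * (2 * rho + 1) by rewrite addr_ge0// mulr_ge0.
  have k1 : 0 <= K * B by rewrite mulr_ge0.
  have k2 : 0 <= 2 * (K * B) by lra.
  by rewrite /cut_const addr_ge0 ?addr_ge0// mulr_ge0.
(* Beyond this radius [eta] also lies outside the support, by the unit bound on the distance. *)
have [h|h] := leP (enorm xi) (2 * rho + 1); last first.
  have x2 : 2 * rho <= enorm xi by lra.
  have e2 : 2 * rho <= enorm eta.
    by have := ler_enorm_sub xi eta; lra.
  have [c0 g0] := cutoff_zero cut x2; have [c1 g1] := cutoff_zero cut e2.
  rewrite /cutD c0 g0 c1 g1 !scale0r trmx0 !mul0mx subrr mulmx0 enorm0.
  by rewrite mulr_ge0 ?enorm_ge0// mulr_ge0// powR_ge0.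
have -> : v *m (cutD u Du xi - cutD u Du eta) =
   (chi xi - chi eta) *: (v *m Du xi) + chi eta *: (v *m (Du xi - Du eta)) +
   (v *m ((G xi - G eta)^T *m u xi) + v *m ((G eta)^T *m (u xi - u eta))).
  have dB : (v *m (G xi - G eta)^T) 0 0 =
      (v *m (G xi)^T) 0 0 - (v *m (G eta)^T) 0 0.
    by rewrite linearB/= mulmxBr !mxE.
  rewrite !mul_rank1 dB (mulmxBr v (cutD _ _ _)) (mulmxBr v (Du _)) /cutD.
  rewrite !mulmxDr !mul_rank1 -!scalemxAr.
  move: (v *m Du xi) (v *m Du eta) => A A'.
  move: ((v *m (G xi)^T) 0 0) ((v *m (G eta)^T) 0 0) => c c'.
  by apply/rowP => i; rewrite !mxE; ring.
set t := enorm (xi - eta) in d1 *.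
have t0 : 0 <= t by exact: enorm_ge0.
have tt : t <= t `^ a by rewrite le_powR1// t0.
have Kt : K * t <= K * t `^ a by rewrite ler_wpM2l.
have p1 : enorm ((chi xi - chi eta) *: (v *m Du xi)) <=
    K * B * t `^ a * enorm v.
  rewrite enormZ; apply: (@le_trans _ _ (K * t `^ a * (B * enorm v))).
    apply: ler_pM; rewrite ?enorm_ge0//; last exact: Dl.
    exact: (le_trans (cutoff_lip cut d1) Kt).
  by rewrite le_eqVlt; apply/orP; left; apply/eqP; ring.
have p2 : enorm (chi eta *: (v *m (Du xi - Du eta))) <= K0 * t `^ a * enorm v.
  rewrite enormZ; apply: (le_trans _ (Dh xi eta v)).
  by rewrite ler_piMl ?enorm_ge0//; exact: cutoff_le cut _.
have p3 : enorm (v *m ((G xi - G eta)^T *m u xi)) <=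
    K * (B0 + B * (2 * rho + 1)) * t `^ a * enorm v.
  apply: le_trans (enorm_rank1 _ _ _) _; rewrite ler_wpM2r ?enorm_ge0//.
  apply: (@le_trans _ _ (K * t `^ a * (B0 + B * (2 * rho + 1)))).
    apply: ler_pM; rewrite ?enorm_ge0//.
      exact: (le_trans (cutoff_grad_lip cut d1) Kt).
    by apply: le_trans (enorm_affine_le xi) _; rewrite lerD2l ler_wpM2l.
  by rewrite le_eqVlt; apply/orP; left; apply/eqP; ring.
have p4 : enorm (v *m ((G eta)^T *m (u xi - u eta))) <=
    K * B * t `^ a * enorm v.
  apply: le_trans (enorm_rank1 _ _ _) _; rewrite ler_wpM2r ?enorm_ge0//.
  rewrite -mulrA; apply: ler_pM; rewrite ?enorm_ge0//.
    exact: cutoff_grad_le cut _.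
  by apply: le_trans (ul _ _) _; rewrite ler_wpM2l.
apply: le_trans (ler_enormD _ _) _.
have -> : cut_const * t `^ a * enorm v =
  (K * B * t `^ a * enorm v + K0 * t `^ a * enorm v) +
  (K * (B0 + B * (2 * rho + 1)) * t `^ a * enorm v + K * B * t `^ a * enorm v).
  by rewrite /cut_const; ring.
apply: lerD; apply: le_trans (ler_enormD _ _) _; exact: lerD.
Qed.

(** At distance at most 1 this is [cutD_holder1]. At larger distances twice the sup bound [C]
    suffices, since the power of the distance is then at least 1. *)
Lemma cut_C1a : 0 <= rho -> C1a (cutf u) (cutD u Du) a.
Proof.
move=> rho0; split; first exact: cut_hasDeriv.
pose C := B + K * (B0 + B * (2 * rho)).
move=> K' _; exists (Num.max cut_const (2 * C)) => xi eta _ _ v.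
have [d1|d1] := leP (enorm (xi - eta)) 1.
  apply: le_trans (cutD_holder1 rho0 d1 v) _.
  rewrite ler_wpM2r ?enorm_ge0// ler_wpM2r ?powR_ge0//.
  by rewrite le_max lexx.
have p1 : 1 <= enorm (xi - eta) `^ a.
  have -> : 1 = 1 `^ a :> R by rewrite powR1.
  by rewrite ge0_ler_powR ?nnegrE ?ler01 ?enorm_ge0 ?(ltW a0) ?(ltW d1).
rewrite mulmxBr; apply: le_trans (ler_enormB _ _) _.
have c1 := cutD_le xi rho0 v; have c2 := cutD_le eta rho0 v.
apply: (@le_trans _ _ (2 * C * enorm v)); first by rewrite /C; lra.
rewrite ler_wpM2r ?enorm_ge0//.
have C0 : 0 <= 2 * C.
  have r2 : 0 <= 2 * rho by lra.
  have B00 : 0 <= B0 by apply: le_trans u0; exact: enorm_ge0.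
  rewrite mulr_ge0// /C addr_ge0// mulr_ge0 ?(cutoff_const_ge0 cut)//.
  by rewrite addr_ge0// mulr_ge0.
apply: (@le_trans _ _ (Num.max cut_const (2 * C))).
  by rewrite le_max lexx orbT.
by rewrite ler_peMr// le_max C0 orbT.
Qed.

End Fixed.

End CutoffProduct.

(** * Interpolation between the sup norm and a Hölder bound on the derivative *)

Section Interpolation.
Variables (R : realType) (m n : nat).
Implicit Types (h : 'rV[R]_m -> 'rV[R]_n) (Dh : 'rV[R]_m -> 'M[R]_(m, n)).

(** The derivative is compared with a difference quotient of step [t]: the values of [h] cost 2 eps
    / t and the Hölder bound controls the remainder. *)
Lemma deriv_interpolation h Dh (K a eps t : R) xi :
  0 < a -> 0 <= K -> 0 < t <= 1 -> hasDeriv h Dh ->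
  (forall zeta, enorm (h zeta) <= eps) ->
  (forall zeta eta, enorm (zeta - eta) <= 1 ->
    opnorm_le (Dh zeta - Dh eta) (K * enorm (zeta - eta) `^ a)) ->
  opnorm_le (Dh xi) (2 * eps / t + K * t `^ a).
Proof.
move=> a0 K0 /andP[t0 t1] hD he hK v.
have [->|v0] := eqVneq v 0; first by rewrite mul0mx !enorm0 mulr0.
have {}v0 := enorm_gt0 v0.
pose s := t / enorm v; have s0 : 0 < s by rewrite divr_gt0.
have sE : enorm (s *: v) = t by rewrite enormZ gtr0_norm// divfK// gt_eqF.
have sB : xi + s *: v - xi = s *: v by rewrite addrC addKr.
have := @mean_value R m n h Dh xi (xi + s *: v) (Dh xi) (K * t `^ a) hD.
rewrite sB sE => H.
have {}H : enorm (h (xi + s *: v) - h xi - s *: v *m Dh xi) <= K * t `^ a * t.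
  apply: H => z zt w; apply: le_trans (hK _ _ (le_trans zt t1) _) _.
  rewrite ler_wpM2r ?enorm_ge0// ler_wpM2l//.
  by rewrite ge0_ler_powR ?nnegrE ?enorm_ge0 ?(ltW a0) ?(ltW t0).
rewrite -(ler_pM2l s0).
have -> : s * ((2 * eps / t + K * t `^ a) * enorm v) =
    eps + eps + K * t `^ a * t.
  by rewrite /s; field; rewrite !gt_eqF.
rewrite -[s in s * enorm _]gtr0_norm// -enormZ scalemxAl.
move: H; set E := _ - s *: v *m Dh xi => H.
have -> : s *: v *m Dh xi = h (xi + s *: v) - h xi - E by rewrite opprB addrC subrK.
apply: le_trans (ler_enormB _ _) _; apply: lerD => //.
by apply: le_trans (ler_enormB _ _) _; exact: lerD.
Qed.

(** For the a'-seminorm, distances up to [s] use the a-Hölder bound and its spare power a - a',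
    while larger distances use smallness of the derivative. The budget is e/4 for the values, e/4
    for the derivative and e/2 for the seminorm. *)
Lemma C1a_interpolation (K a a' e : R) : 0 < a' -> a' < a -> 0 <= K -> 0 < e ->
  exists2 eps : R, 0 < eps & forall h Dh, hasDeriv h Dh ->
    (forall zeta, enorm (h zeta) <= eps) ->
    (forall zeta eta, enorm (zeta - eta) <= 1 ->
      opnorm_le (Dh zeta - Dh eta) (K * enorm (zeta - eta) `^ a)) ->
    C1a_norm_le h Dh a' e.
Proof.
move=> a'0 a'a K0 e0; have a0 : 0 < a by exact: lt_trans a'a.
have K1 : 0 < K + 1 by lra.
have KK c : 0 <= c -> K * (c / (K + 1)) <= c.
  by move=> c0; rewrite mulrA ler_pdivrMr//; nra.
have [||//|s /andP[s0 s1] sP] := @exists_powR_le R (a - a') (e / 4 / (K + 1)) 1.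
- by rewrite subr_gt0.
- by rewrite !divr_gt0.
(* [sg] is the target bound on the derivative; the second entry keeps 2 sg / s^a' at most e/4.
   Below, [t] and [eps] are chosen so that each half of the interpolation bound is at most sg/2. *)
pose sg := Num.min (e / 4) (e / 8 * s `^ a').
have sg0 : 0 < sg by rewrite lt_min !(divr_gt0, mulr_gt0) ?powR_gt0.
have sg1 : sg <= e / 4 by rewrite ge_min lexx.
have sg2 : sg <= e / 8 * s `^ a' by rewrite ge_min lexx orbT.
have [|//|t /andP[t0 t1] tP] := @exists_powR_le R a (sg / 2 / (K + 1)) 1 a0.
  by rewrite !divr_gt0.
pose eps := Num.min (e / 4) (sg * t / 4).
exists eps; first by rewrite lt_min !(divr_gt0, mulr_gt0).
move=> h Dh hD he hK xi1 xi2 xi3 eta3 v w xe v1 w1.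
have Ds xi : opnorm_le (Dh xi) sg.
  move=> z; have t01 : 0 < t <= 1 by rewrite t0.
  apply: le_trans (deriv_interpolation xi a0 K0 t01 hD he hK z) _.
  rewrite ler_wpM2r ?enorm_ge0//.
  have -> : sg = sg / 2 + sg / 2 by lra.
  apply: lerD.
    rewrite ler_pdivrMr//; have : eps <= sg * t / 4 by rewrite ge_min lexx orbT.
    lra.
  apply: le_trans (KK (sg / 2) _); last by rewrite divr_ge0// ltW.
  by rewrite ler_wpM2l// tP// lexx ltW.
have -> : e = e / 4 + e / 4 + e / 2 by lra.
apply: lerD; first apply: lerD.
- by apply: le_trans (he _) _; rewrite ge_min lexx.
- apply: le_trans (Ds _ _) _; apply: le_trans sg1.
  by rewrite ler_piMr// ltW.
set th := enorm (xi3 - eta3).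
have th0 : 0 < th by rewrite enorm_gt0// subr_eq0.
rewrite ler_pdivrMr ?powR_gt0//.
have [ths|sth] := leP th s.
  apply: le_trans (hK _ _ (le_trans ths s1) _) _.
  apply: (@le_trans _ _ (K * th `^ a)).
    by rewrite ler_piMr// mulr_ge0// powR_ge0.
  have -> : a = (a - a') + a' by rewrite subrK.
  rewrite powRD; last by rewrite (gt_eqF th0) implybT.
  rewrite mulrA ler_wpM2r ?powR_ge0//.
  apply: (@le_trans _ _ (e / 4)); last by lra.
  apply: le_trans (KK (e / 4) _); last by rewrite divr_ge0// ltW.
  by rewrite ler_wpM2l// sP// ths ltW.
rewrite mulmxBr; apply: le_trans (ler_enormB _ _) _.
have sa : s `^ a' <= th `^ a'.
  by rewrite ge0_ler_powR ?nnegrE ?(ltW s0) ?(ltW th0) ?(ltW a'0) ?(ltW sth).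
have D1 : enorm (w *m Dh xi3) <= sg.
  by apply: le_trans (Ds _ _) _; rewrite ler_piMr// ltW.
have D2 : enorm (w *m Dh eta3) <= sg.
  by apply: le_trans (Ds _ _) _; rewrite ler_piMr// ltW.
nra.
Qed.

End Interpolation.

(** * Nearby sets as graphs over one tangent plane *)

Section LocalGraphs.
Variables (R : realType) (m n : nat) (Rad L a r delta : R).
Hypotheses (a0 : 0 < a) (a1 : a <= 1) (L0 : 0 <= L).
Hypotheses (r0 : 0 < r) (rR : 4 * r < Rad) (dr : delta <= r / 64).
Hypothesis Lr : forall t, 0 <= t <= 4 * r -> L * t `^ a <= 1 / 64.
Variables (S0 T : set 'rV[R]_n) (x : 'rV[R]_n) (Q : 'M[R]_(m, n)).
Variables (f0 : 'rV[R]_m -> 'rV[R]_n) (D0 : 'rV[R]_m -> 'M[R]_(m, n)).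
Hypothesis C0 : chart Rad L a S0 x Q f0 D0.

(** The constants are those of [regraph]. The radius 3 Rad / 4 leaves room for moving the centre
    from a nearby point of [T] to [x]. *)
Definition graph_over (g : 'rV[R]_m -> 'rV[R]_n)
    (Dg : 'rV[R]_m -> 'M[R]_(m, n)) :=
  [/\ into_perp Q g, hasDeriv g Dg,
      forall z, enorm (z - x) < Rad / 2 + Rad / 4 -> T z <-> graph_at x Q g z &
      [/\ forall eta zeta, enorm (g eta - g zeta) <= 5 * enorm (eta - zeta),
          forall eta, opnorm_le (Dg eta) 5 & holder Dg (20 * L) a]].

(** A chart of [T] at a point near [x] has a plane close to that of [Q]. Tilting is estimated in
    both directions, after which [regraph] applies. *)
Lemma local_graph : S0 x -> hausdorff_le T S0 delta ->
  (forall y, T y ->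
    exists (Q' : 'M[R]_(m, n)) f Df, chart Rad L a T y Q' f Df) ->
  exists g Dg, graph_over g Dg.
Proof.
move=> Sx [TS ST] Tc; have [y Ty yx] := ST x Sx.
have [Q' [f [Df C]]] := Tc y Ty.
have t1 : forall v, enorm (v *m Q' - v *m Q' *m Q^T *m Q) <= 1 / 4 * enorm v.
  exact: (chart_tilt a0 L0 r0 rR dr Lr C C0 yx).
have t2 : forall v, enorm (v *m Q - v *m Q *m Q'^T *m Q') <= 1 / 4 * enorm v.
  apply: (chart_tilt a0 L0 r0 rR dr Lr C0 C); first by rewrite enorm_distC.
  by move=> z /ST[z' Tz' zz']; exists z' => //; rewrite enorm_distC.
have [oQ _ _ _ _] := C0; have [oQ' fp fD E [_ _ fh fl]] := C.
have [g [Dg [gp gD gE gb]]] := regraph x y a0 a1 L0 oQ oQ' fp fD fh fl t1 t2.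
exists g, Dg; split=> // z zx.
have zy : eball y Rad z.
  rewrite /eball/=; have := ler_enorm_dist x z y.
  rewrite (enorm_distC x y); have := dr; have := rR; have := r0; lra.
rewrite -gE; split=> [Tz|gz].
  by have [] : (graph_at y Q' f `&` eball y Rad) z by rewrite -E.
by have [] : (T `&` eball y Rad) z by rewrite E.
Qed.

(** A point of [T] within [e] of the graph point of [f0] over [eta] has a planar coordinate within
    [e] of [eta], hence a normal part within 2 e of [f0 eta]. Moving the coordinate back costs 5 e
    by the Lipschitz bound. *)
Lemma local_graph_close g Dg (e : R) eta : graph_over g Dg ->
  hausdorff_le T S0 e -> e <= Rad / 8 -> enorm eta <= Rad / 4 ->
  enorm (g eta - f0 eta) <= 7 * e.
Proof.
move=> [gp _ gT [gl _ _]] [_ ST] eR etaR.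
have [oQ fp _ _ _] := C0.
have Rad0 : 0 < Rad by have := r0; have := rR; lra.
have p2 : enorm (eta *m Q + f0 eta) <= Rad / 2.
  apply: le_trans (ler_enormD _ _) _; rewrite enorm_ortho//.
  have := chart_lip0 eta C0; lra.
have Sp : S0 (x + (eta *m Q + f0 eta)) by apply: (chart_graph C0); lra.
have [q Tq qp] := ST _ Sp.
have /gT/iffLR/(_ Tq)[zeta _ qE] : enorm (q - x) < Rad / 2 + Rad / 4.
  have := ler_enorm_dist (x + (eta *m Q + f0 eta)) q x.
  rewrite [x + _ - x]addrC addKr; lra.
move: qp; rewrite -qE opprD addrACA subrr add0r.
have -> : zeta *m Q + g zeta - (eta *m Q + f0 eta) =
    (zeta - eta) *m Q + (g zeta - f0 eta).
  by rewrite mulmxBl opprD addrACA.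
move=> qp.
have ze : enorm (zeta - eta) <= e.
  apply: le_trans qp; apply: le_trans (ler_enorm_orthoT oQ _).
  rewrite (mulmxDl _ _ Q^T) mulmx_orthoK// (mulmxBl _ _ Q^T) gp fp subrr.
  by rewrite addr0.
have ge : enorm (g zeta - f0 eta) <= 2 * e.
  have := ler_enorm_sub (g zeta - f0 eta) (- ((zeta - eta) *m Q)).
  rewrite opprK enormN enorm_ortho// addrC [_ + _ *m Q]addrC; lra.
have := ler_enorm_dist (g zeta) (g eta) (f0 eta); have := gl eta zeta.
rewrite (enorm_distC eta); lra.
Qed.

End LocalGraphs.

(** * Localised graphs and the convergent subsequence *)

Lemma graph_cutoff (R : realType) m n (rho K : R) chi G x (Q : 'M[R]_(m, n)) g :
  cutoff rho K chi G -> orthonormal Q -> into_perp Q g ->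
  graph_at x Q (cutf chi g) `&` eball x rho = graph_at x Q g `&` eball x rho.
Proof.
move=> cut oQ gp.
have cp : into_perp Q (cutf chi g).
  by move=> xi; rewrite /cutf -scalemxAl gp scaler0.
(* Projection to the plane does not increase length, so a graph point in the ball of radius [rho]
   has its coordinate where [chi] is 1. This is used for both the original and the cut off
   function. *)
have small u xi : into_perp Q u -> eball x rho (x + (xi *m Q + u xi)) ->
    cutf chi g xi = g xi.
  move=> up; rewrite /eball/= [x + _ - x]addrC addKr => xr.
  rewrite /cutf (cutoff_one cut) ?scale1r//.
  apply: le_trans (ltW xr); apply: le_trans (ler_enorm_orthoT oQ _).
  by rewrite mulmxDl mulmx_orthoK// up addr0.
apply/seteqP; split=> z [[xi _ <-] xr]; split=> //; exists xi => //.
  by rewrite (small _ _ cp xr).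
by rewrite (small _ _ gp xr).
Qed.

Lemma charts_classCRLd (R : realType) m n (Rad L d a : R) (S : set 'rV[R]_n) :
  0 < Rad -> compact S -> S `<=` ecball 0 d ->
  (forall x, S x -> exists (Q : 'M[R]_(m, n)) f Df, chart Rad L a S x Q f Df) ->
  classCRLd m a Rad L d S.
Proof.
move=> Rad0 cS Sd Sc; split=> //; split=> // x /Sc[Q [f [Df]]].
move=> [oQ fp fD E [_ _ fh _]]; exists Rad => //; exists Q, f, Df.
by split=> //; split=> // K _; exists L => xi eta _ _; exact: fh.
Qed.

Theorem mainTheorem4 (R : realType) (m n : nat) (Rad L d a : R)
  (hRad : 0 < Rad) (hL : 0 < L) (hd : 0 < d) (ha0 : 0 < a) (ha1 : a <= 1)
  (S : nat -> set 'rV[R]_n)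
  (hS : forall j, classCRLd m a Rad L d (S j)) :
  exists phi : nat -> nat, (forall i, (phi i < phi i.+1)%N) /\
    exists S0 : set 'rV[R]_n,
      cvgC m a (fun i => S (phi i)) S0 /\ classCRLd m a Rad L d S0.
Proof.
have [U [UF Uoo]] := ultraFilterLemma (_ : ProperFilter (\oo : set_system nat)).
have Sd j : S j `<=` ecball 0 d by have [] := hS j.
have Sc j y : S j y ->
    exists (Q : 'M[R]_(m, n)) f Df, chart Rad L a (S j) y Q f Df.
  by have [_ _] := hS j; exact.
have L0 := ltW hL.
pose S0 := ulimset S U.
have S0c x : S0 x -> exists (Q : 'M[R]_(m, n)) f Df, chart Rad L a S0 x Q f Df.
  exact: ulimset_chart.
have S0C : classCRLd m a Rad L d S0.
  apply: charts_classCRLd => //; last exact: ulimset_bounded.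
  apply: (bounded_closed_ecompact (ulimset_bounded UF Uoo Sd)).
  exact: ulimset_closed.
have inv0 (i : nat) : 0 < i.+1%:R^-1 :> R by rewrite invr_gt0.
have [phi [phiS phiH]] := ultra_subseq UF Uoo
  (fun i => ulimset_hausdorff UF Uoo Sd (inv0 i)).
exists phi; split=> //; exists S0; split=> //.
have small (e : R) : 0 < e -> exists N, forall j, (N <= j)%N ->
    hausdorff_le (S (phi j)) S0 e.
  move=> e0; have [N _ HN] := near_infty_natSinv_lt (PosNum e0).
  exists N => j Nj; have [H1 H2] := phiH j; have je := ltW (HN j Nj).
  split=> [y /H1[z Sz yz]|z /H2[y Sy yz]].
    by exists z => //; exact: le_trans yz je.
  by exists y => //; exact: le_trans yz je.
split=> //; first by have [[]] := S0C.
(* With 4 r = s, the Hölder bound on the derivative is at most 1/64 up to radius 4 r, the flatness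
   required by the tilt estimate. *)
have [||s /andP[s0 sR] sP] := @exists_powR_le R a (1 / (64 * L)) (Rad / 8) ha0.
- by rewrite divr_gt0// mulr_gt0.
- by rewrite divr_gt0.
pose r := s / 4; pose delta := r / 64.
have r0 : 0 < r by rewrite divr_gt0.
have r4 : 4 * r = s by rewrite /r; lra.
have rR : 4 * r < Rad by lra.
have d0 : 0 < delta by rewrite divr_gt0.
have Lr t : 0 <= t <= 4 * r -> L * t `^ a <= 1 / 64.
  rewrite r4 => /sP; rewrite ler_pdivlMr ?mulr_gt0//; lra.
have [j0 j0P] := small delta d0.
(* The cutoff then vanishes from radius 2 rho = Rad / 4 on, and inside that radius
   [local_graph_close] applies. *)
pose rho := Rad / 8; have rho0 : 0 < rho by rewrite divr_gt0.
have [K [chi [G cut]]] := cutoff_exists m rho0.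
have K_ge0 := cutoff_const_ge0 cut.
exists j0, rho => // x Sx; have [Q [f0 [D0 C0]]] := S0c x Sx.
have [oQ f0p f0D f0E [f00 D00 f0h f0l]] := C0.
have f0l1 xi eta : enorm (f0 xi - f0 eta) <= 1 * enorm (xi - eta).
  by rewrite mul1r.
have D0l xi : opnorm_le (D0 xi) 1 by exact: (deriv_le1 f0D f0l).
have gex j : exists gd, (j0 <= j)%N ->
    graph_over Rad L a (S (phi j)) x Q gd.1 gd.2.
  have [jj|jj] := leqP j0 j; last by exists (fun=> 0, fun=> 0).
  have [g [Dg gg]] := local_graph ha0 ha1 L0 r0 rR (lexx delta) Lr C0 Sx
    (j0P j jj) (@Sc (phi j)).
  by exists (g, Dg).
have {gex}[gd gdP] := choice gex.
(* The norm in the conclusion is a supremum over the whole plane, while closeness is known only near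
   0. The cutoff makes the differences compactly supported and leaves the graphs in the ball of
   radius [rho] unchanged. *)
exists Q, (cutf chi f0), (cutD chi G f0 D0).
exists (fun j => cutf chi (gd j).1), (fun j => cutD chi G (gd j).1 (gd j).2).
split=> //.
- split.
  + by move=> xi; rewrite /cutf -scalemxAl f0p scaler0.
  + exact: (cut_C1a ha0 ha1 cut (lexx (enorm (f0 0))) ler01 L0 f0l1 D0l
      f0D f0h (ltW rho0)).
  + by rewrite /cutf f00 scaler0.
  + by rewrite /cutD f00 D00 scaler0 mulmx0 addr0.
  + rewrite (graph_cutoff _ cut oQ f0p).
    have sub : eball x rho `<=` eball x Rad.
      by move=> z; rewrite /eball/= /rho; lra.
    by rewrite -(setIidr sub) !setIA f0E.
- move=> j jj; have [gp gD gT [gl gDl gh]] := gdP j jj.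
  have L20 : 0 <= 20 * L by lra.
  split.
  + by move=> xi; rewrite /cutf -scalemxAl gp scaler0.
  + exact: (cut_C1a ha0 ha1 cut (lexx (enorm ((gd j).1 0))) (ler0n _ 5) L20
      gl gDl gD gh (ltW rho0)).
  + rewrite (graph_cutoff _ cut oQ gp).
    apply/seteqP; split=> z [Az zr]; split=> //; apply/gT => //;
      by move: zr; rewrite /eball/= /rho; lra.
move=> a' a'0 a'a e e0.
(* Uniform bounds for the difference [u]: 6 = 5 + 1 for its Lipschitz constant and derivative, 7
   delta for its value at 0, and 21 L = 20 L + L for its Hölder constant. None depends on [j]. *)
pose K' := cut_const rho K 6 (7 * delta) (21 * L).
have K'0 : 0 <= K'.
  have : 0 <= K * (7 * delta + 6 * (2 * rho + 1)) by rewrite mulr_ge0//; lra.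
  by rewrite /K' /cut_const; lra.
have [eps eps0 epsP] := @C1a_interpolation R m n K' a a' e a'0 a'a K'0 e0.
(* The first entry makes [local_graph_close] applicable; the second turns its bound 7 e1 into
   [eps]. *)
pose e1 := Num.min (Rad / 8) (eps / 7).
have e10 : 0 < e1 by rewrite lt_min !divr_gt0.
have [N NP] := small e1 e10; exists N => j jj Nj.
have gg := gdP j jj; have [gp gD gT [gl gDl gh]] := gg.
set g := (gd j).1 in gg gp gD gT gl *; set Dg := (gd j).2 in gg gD gDl gh *.
pose u xi := g xi - f0 xi; pose Du xi := Dg xi - D0 xi.
have -> : (fun xi => cutf chi g xi - cutf chi f0 xi) = cutf chi u.
  by apply/funext => xi; rewrite /cutf -scalerBr.
have -> : (fun xi => cutD chi G g Dg xi - cutD chi G f0 D0 xi) = cutD chi G u Du.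
  apply/funext => xi; rewrite /cutD /u /Du scalerBr mulmxBr.
  by rewrite opprD addrACA.
have uD : hasDeriv u Du.
  move=> xi c c0; have c2 : 0 < c / 2 by rewrite divr_gt0.
  have [d1 d10 H1] := gD xi _ c2; have [d2 d20 H2] := f0D xi _ c2.
  exists (Num.min d1 d2); first by rewrite lt_min d10.
  move=> eta; rewrite lt_min => /andP[/H1 h1 /H2 h2].
  have -> : u eta - u xi - (eta - xi) *m Du xi =
      g eta - g xi - (eta - xi) *m Dg xi -
      (f0 eta - f0 xi - (eta - xi) *m D0 xi).
    rewrite /u /Du mulmxBr; move: (_ *m Dg xi) (_ *m D0 xi) => A B.
    by apply/rowP => i; rewrite !mxE; ring.
  by apply: le_trans (ler_enormB _ _) _; lra.
have ul xi eta : enorm (u xi - u eta) <= 6 * enorm (xi - eta).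
  have -> : u xi - u eta = g xi - g eta - (f0 xi - f0 eta).
    by apply/rowP => i; rewrite !mxE; ring.
  apply: le_trans (ler_enormB _ _) _.
  have := gl xi eta; have := f0l xi eta; lra.
have Dl xi : opnorm_le (Du xi) 6.
  move=> v; rewrite /Du mulmxBr; apply: le_trans (ler_enormB _ _) _.
  have := gDl xi v; have := D0l xi v; lra.
have Dh : holder Du (21 * L) a.
  move=> xi eta v.
  have -> : Du xi - Du eta = Dg xi - Dg eta - (D0 xi - D0 eta).
    by apply/matrixP => i k; rewrite !mxE; ring.
  rewrite mulmxBr; apply: le_trans (ler_enormB _ _) _.
  by have := gh xi eta v; have := f0h xi eta v; lra.
have u0 : enorm (u 0) <= 7 * delta.
  apply: (local_graph_close r0 rR C0 gg (j0P j jj)).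
    by rewrite /delta; lra.
  by rewrite enorm0; lra.
have L21 : 0 <= 21 * L by lra.
apply: epsP.
- exact: (cut_hasDeriv ha0 ha1 cut (ler0n _ 6) L21 ul uD Dh).
- move=> xi; have [h|h] := leP (2 * rho) (enorm xi).
    by have [c0 _] := cutoff_zero cut h; rewrite /cutf c0 scale0r enorm0 ltW.
  rewrite /cutf enormZ; apply: (@le_trans _ _ (enorm (u xi))).
    by rewrite ler_piMl ?enorm_ge0//; exact: cutoff_le cut _.
  apply: (@le_trans _ _ (7 * e1)).
    apply: (local_graph_close r0 rR C0 gg (NP j Nj)).
      by rewrite ge_min lexx.
    by move: h; rewrite /rho; lra.
  have : e1 <= eps / 7 by rewrite ge_min lexx orbT.
  lra.
- move=> xi eta d1.
  exact: (cutD_holder1 ha0 ha1 cut u0 (ler0n _ 6) L21 ul Dl Dh (ltW rho0) d1).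
Qed.
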